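(* Let $\mathsf{D}_{\mathrm{ET}}$ be a regular Entropy-Transport distance induced by $(a,F,\ell)$, with induced Sturm-Entropy-Transport distance $\mathbf{D}_{\mathrm{ET}}$, let $p\ge 1$, and let $\mathrm{CGW}^a$ be the associated conic Gromov-Wasserstein distance. For any pair of metric measure spaces $(X_1,d_1,\mu_1)$, $(X_2,d_2,\mu_2)$ it holds $$\mathrm{CGW}^a\big((X_1,d_1,\mu_1),(X_2,d_2,\mu_2)\big)\le\big(\mu_1(X_1)^a+\mu_2(X_2)^a\big)\,\mathbf{D}_{\mathrm{ET}}\big((X_1,d_1,\mu_1),(X_2,d_2,\mu_2)\big).$$
   Context: For a complete separable metric space $X$, $\mathscr{M}(X)$ denotes the set of finite nonnegative Borel measures on $X$, endowed with the weak topology (duality with bounded continuous functions). $\Gamma_0(\mathbb{R}_+)$ is the set of convex, lower semicontinuous $F:[0,\infty)\to[0,\infty]$ with $F(1)=0$; $F'_\infty:=\lim_{s\to\infty}F(s)/s$, and $F$ is superlinear if $F'_\infty=+\infty$. The $F$-divergence is $D_F(\gamma\|\mu):=\int_X F(\sigma)\,d\mu+F'_\infty\,\gamma^\perp(X)$, where $\gamma=\sigma\mu+\gamma^\perp$ is the Lebesgue decomposition of $\gamma$ with respect to $\mu$ (with $\infty\cdot 0=0$). The Entropy-Transport cost induced by $F$ and a lower semicontinuous cost $c:X\times X\to[0,\infty]$ is $$\mathrm{ET}(\mu_1,\mu_2):=\inf_{\gamma\in\mathscr{M}(X\times X)}\Big\{D_F(\gamma_1\|\mu_1)+D_F(\gamma_2\|\mu_2)+\int_{X\times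 X} c\,d\gamma\Big\},$$ where $\gamma_i=(\pi^i)_\sharp\gamma$ are the marginals of $\gamma$. Regular Entropy-Transport distance induced by $(a,F,\ell)$: here $a\in(0,1]$, $F\in\Gamma_0(\mathbb{R}_+)$ is superlinear and finite valued, $\ell:[0,\infty)\to[0,\infty]$ is continuous, convex, with $\ell(s)=0$ iff $s=0$; for every complete separable metric space $(X,d)$ one sets $\mathsf{D}_{\mathrm{ET}}:=\mathrm{ET}^a$ on $\mathscr{M}(X)$, with $\mathrm{ET}$ induced by $F$ and $c(x_1,x_2)=\ell(d(x_1,x_2))$, and it is required that, for every complete separable metric space $(X,d)$, $\mathsf{D}_{\mathrm{ET}}$ is a complete and separable metric on $\mathscr{M}(X)$ inducing the weak topology. A metric measure space is a triple $(X,d,\mu)$ with $(X,d)$ a complete separable metric space and $\mu\in\mathscr{M}(X)$; $\mathsf{supp}(\mu)$ is the support of $\mu$. The Sturm-Entropy-Transport distance is $$\mathbf{D}_{\mathrm{ET}}\big((X_1,d_1,\mu_1),(X_2,d_2,\mu_2)\big):=\inf\ \mathsf{D}_{\mathrm{ET}}(\psi^1_\sharp\mu_1,\psi^2_\sharp\mu_2),$$ the infimum over all complete separable metric spaces $(\hat X,\hat d)$ and isometric embeddings $\psi^i:\mathsf{supp}(\mu_i)\to\hat X$, $i=1,2$ (with $\mathsf{D}_{\mathrm{ET}}$ computed in $(\hat X,\hat d)$). Marginal perspective function: let $R(t):=tF(1/t)$ for $t>0$, $R(0):=F'_\infty$ (reverse entropy). For $c\in[0,\infty)$, $H_c:[0,\infty)^2\to[0,\infty]$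 is the lower semicontinuous envelope of $\tilde H_c(r_1,r_2):=\inf_{\theta>0}\{\theta R(r_1/\theta)+\theta R(r_2/\theta)+\theta c\}$; for $c=+\infty$, $H_\infty(r_1,r_2):=F(0)r_1+F(0)r_2$. Cone: $\mathfrak{C}(X):=(X\times[0,\infty))/\!\sim$ where $(x_1,r_1)\sim(x_2,r_2)$ iff $r_1=r_2=0$ or ($r_1=r_2$ and $x_1=x_2$), with the usual cone topology (the one induced by the cone metric, in which the sets $\{[x,r]:r<\varepsilon\}$ form a neighbourhood basis of the vertex); $[x,r]$ is the class of $(x,r)$. Fix $\bar x\in X$ and set $\mathsf{r}[x,r]:=r$; $\mathsf{x}[x,r]:=x$ if $r>0$ and $\mathsf{x}[x,r]:=\bar x$ if $r=0$. On $\mathfrak{C}(X_1)\times\mathfrak{C}(X_2)$ let $\mathsf{r}_i,\mathsf{x}_i$ be these maps applied to the $i$-th component. For $\alpha\in\mathscr{M}(\mathfrak{C}(X_1)\times\mathfrak{C}(X_2))$ the $p$-homogeneous marginals are $\mathfrak{h}^p_i(\alpha):=(\mathsf{x}_i)_\sharp(\mathsf{r}_i^p\,\alpha)$, and $\mathcal{U}_p(\mu_1,\mu_2):=\{\alpha\in\mathscr{M}(\mathfrak{C}(X_1)\times\mathfrak{C}(X_2)):\mathfrak{h}^p_i(\alpha)=\mu_i,\ i=1,2\}$. Conic Gromov-Wasserstein: $\mathrm{CGW}\big((X_1,d_1,\mu_1),(X_2,d_2,\mu_2)\big):=\inf_{\alpha\in\mathcal{U}_p(\mu_1,\mu_2)}\mathcal{H}(\alpha)$,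 where $$\mathcal{H}(\alpha):=\iint H_{\ell(|d_1(x,x')-d_2(y,y')|)}\big((rr')^p,(ss')^p\big)\,d\alpha([x,r],[y,s])\,d\alpha([x',r'],[y',s']),$$ and $\mathrm{CGW}^a$ denotes its power $a$. *)

(* Defs.v *)
From HB Require Import structures.
From mathcomp Require Import all_boot all_order all_algebra.
From mathcomp Require Import all_classical all_reals all_analysis.

Set Implicit Arguments.
Unset Strict Implicit.
Unset Printing Implicit Defensive.

Import Order.TTheory GRing.Theory Num.Theory.
Import numFieldNormedType.Exports.

Local Open Scope classical_set_scope.
Local Open Scope ring_scope.

(** * Complete separable metric spaces and finite Borel measures *)

HB.mixin Record isSeparable T & Topological T := {
  separable_subproof : exists2 S : set T, countable S & dense S
}.

(* The library's complete spaces are pointed, hence nonempty; the empty space,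
   which carries only the null measure, is left out. *)
#[short(type="polishMetricType")]
HB.structure Definition PolishMetric (R : numDomainType) :=
  {T of Metric R T & Complete T & isSeparable T}.

HB.instance Definition _ (T U : ptopologicalType) := Pointed.on (T * U)%type.

Definition borel (T : ptopologicalType) : Type := g_sigma_algebraType (@open T).
HB.instance Definition _ (T : ptopologicalType) :=
  Measurable.copy (borel T) (g_sigma_algebraType (@open T)).

Definition fmeas (R : realType) (T : ptopologicalType) : Type :=
  {finite_measure set (borel T) -> \bar R}.

HB.instance Definition _ (R : realType) (T : ptopologicalType) :=
  gen_eqMixin (fmeas R T).
HB.instance Definition _ (R : realType) (T : ptopologicalType) :=
  gen_choiceMixin (fmeas R T).

Definition bcont (R : realType) (T : ptopologicalType) : Type :=
  {f : T -> R | continuous f /\ bounded_fun f}.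

Definition weak_eval (R : realType) (T : ptopologicalType) (mu : fmeas R T) :
    {ptws bcont R T -> R} :=
  fun f => (\int[mu]_(x in setT) sval f x)%R.

HB.instance Definition _ (R : realType) (T : ptopologicalType) :=
  Topological.copy (fmeas R T) (initial_topology (@weak_eval R T)).

(* A measure is a function on all subsets, whose values are only meaningful on
   the Borel ones: this is the equality of the set of finite Borel measures. *)
Definition fmeas_eq (R : realType) (T : ptopologicalType) (mu nu : fmeas R T) :=
  forall A : set (borel T), measurable A -> mu A = nu A.

Section metric_on_measures.
Local Open Scope ereal_scope.
Context (R : realType) (T : ptopologicalType).
Variable D : fmeas R T -> fmeas R T -> \bar R.

Definition is_metric_on_fmeas : Prop :=
  [/\ forall mu nu, 0 <= D mu nu < +oo,
      forall mu nu, D mu nu = 0 <-> fmeas_eq mu nu,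
      forall mu nu, D mu nu = D nu mu &
      forall mu nu la, D mu la <= D mu nu + D nu la].

Definition complete_on_fmeas : Prop :=
  forall u : nat -> fmeas R T,
    (forall e : R, (0 < e)%R -> exists N : nat,
       forall m n : nat, (N <= m)%N -> (N <= n)%N -> D (u m) (u n) < e%:E) ->
    exists mu : fmeas R T,
      forall e : R, (0 < e)%R -> exists N : nat,
        forall n : nat, (N <= n)%N -> D (u n) mu < e%:E.

Definition separable_on_fmeas : Prop :=
  exists2 S : set (fmeas R T), countable S &
    forall (mu : fmeas R T) (e : R), (0 < e)%R ->
      exists2 nu, S nu & D mu nu < e%:E.

Definition induces_weak_topology : Prop :=
  forall U : set (fmeas R T),
    open U <-> (forall mu, U mu -> exists2 e : R, (0 < e)%R &
                  forall nu, D mu nu < e%:E -> U nu).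

End metric_on_measures.

(** * Entropy functions and Entropy-Transport costs *)

(* Functions on [0, +oo[ are represented by functions on R whose values outside
   [0, +oo[ are irrelevant. *)

Section entropy.
Local Open Scope ereal_scope.
Context (R : realType).
Implicit Types F l : R -> \bar R.

Definition nneg : set R := [set s | (0 <= s)%R].

Definition convex_on_nonneg F : Prop :=
  forall s t lambda : R, (0 <= s)%R -> (0 <= t)%R -> (0 <= lambda <= 1)%R ->
    F (lambda * s + (1 - lambda) * t)%R
      <= lambda%:E * F s + (1 - lambda)%:E * F t.

(* [subspace A] isolates the points outside A. *)
Definition lsc_on (T : topologicalType) (A : set T) (f : T -> \bar R) : Prop :=
  lower_semicontinuous (f : subspace A -> \bar R).

Definition lsc_envelope (T : topologicalType) (A : set T) (f : T -> \bar R)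
    (x : T) : \bar R :=
  ereal_sup [set g x | g in [set g : T -> \bar R |
    lsc_on A g /\ forall y, A y -> g y <= f y]].

Definition Gamma0 F : Prop :=
  [/\ forall s, (0 <= s)%R -> 0 <= F s,
      convex_on_nonneg F,
      lsc_on nneg F &
      F 1%R = 0].

(* F is convex in all uses, hence the limit exists. *)
Definition recession F : \bar R := lim (F s * (s^-1)%:E @[s --> +oo%R]).

Definition superlinear F : Prop := recession F = +oo.

Section divergence.
Context d (T : measurableType d).

Definition lebesgue_decomposition (gamma : set T -> \bar R)
    (mu : {measure set T -> \bar R}) (sigma : T -> R)
    (gperp : {measure set T -> \bar R}) : Prop :=
  [/\ measurable_fun setT sigma,
      forall x, (0 <= sigma x)%R,
      exists2 N, measurable N & mu N = 0 /\ gperp (~` N) = 0 &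
      forall A, measurable A ->
        gamma A = \int[mu]_(x in A) (sigma x)%:E + gperp A].

(* The Lebesgue decomposition exists and is unique (mu-a.e. for sigma), so that
   the infimum is over a single value. *)
Definition divergence F (gamma : set T -> \bar R)
    (mu : {measure set T -> \bar R}) : \bar R :=
  ereal_inf [set v | exists (sigma : T -> R)
                            (gperp : {measure set T -> \bar R}),
    lebesgue_decomposition gamma mu sigma gperp /\
    v = \int[mu]_x F (sigma x) + recession F * gperp setT].

End divergence.

Definition ET (T : ptopologicalType) F (c : T * T -> \bar R)
    (mu1 mu2 : fmeas R T) : \bar R :=
  ereal_inf [set
      divergence F (pushforward gamma (fst : borel (T * T)%type -> borel T)) mu1
    + divergence F (pushforward gamma (snd : borel (T * T)%type -> borel T)) mu2
    + \int[gamma]_z c z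
    | gamma in [set: fmeas R (T * T)%type]].

Definition ET_dist (X : polishMetricType R) (a : R) F l
    (mu1 mu2 : fmeas R X) : \bar R :=
  (ET F (fun z : X * X => l (mdist z.1 z.2)) mu1 mu2) `^ a.

Definition regular_ET (a : R) F l : Prop :=
  [/\ (0 < a <= 1)%R,
      [/\ Gamma0 F, superlinear F & forall s, (0 <= s)%R -> F s \is a fin_num],
      [/\ forall s, (0 <= s)%R -> 0 <= l s,
          {within nneg, continuous l},
          convex_on_nonneg l &
          forall s, (0 <= s)%R -> (l s = 0 <-> s = 0%R)] &
      forall X : polishMetricType R,
        [/\ is_metric_on_fmeas (@ET_dist X a F l),
            complete_on_fmeas (@ET_dist X a F l),
            separable_on_fmeas (@ET_dist X a F l) &
            induces_weak_topology (@ET_dist X a F l)]].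

End entropy.

(** * Sturm-Entropy-Transport distance *)

Section sturm.
Local Open Scope ereal_scope.
Context (R : realType).

Definition supp (T : ptopologicalType) (mu : fmeas R T) : set T :=
  [set x | forall U : set T, open U -> U x -> 0 < mu U].

(* mu is concentrated on its support, so that the right-hand side is the image
   by psi of mu seen as a measure on supp mu. *)
Definition is_supp_pushforward (T U : ptopologicalType) (mu : fmeas R T)
    (psi : supp mu -> U) (nu : fmeas R U) : Prop :=
  forall A : set (borel U), measurable A ->
    nu A = mu (set_val @` (psi @^-1` A)).

Definition isometric_embedding (X Y : polishMetricType R) (A : set X)
    (psi : A -> Y) : Prop :=
  forall x y : A, mdist (psi x) (psi y) = mdist (set_val x) (set_val y).

Definition sturm_ET (a : R) (F l : R -> \bar R) (X1 X2 : polishMetricType R)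
    (mu1 : fmeas R X1) (mu2 : fmeas R X2) : \bar R :=
  ereal_inf [set v | exists (X : polishMetricType R)
      (psi1 : supp mu1 -> X) (psi2 : supp mu2 -> X) (nu1 nu2 : fmeas R X),
    [/\ isometric_embedding psi1, isometric_embedding psi2,
        is_supp_pushforward psi1 nu1, is_supp_pushforward psi2 nu2 &
        v = ET_dist a F l nu1 nu2]].

End sturm.

(** * Marginal perspective function *)

Section perspective.
Local Open Scope ereal_scope.
Context (R : realType).
Implicit Types F : R -> \bar R.

Definition reverse_entropy F (t : R) : \bar R :=
  if t == 0%R then recession F else t%:E * F (t^-1)%R.

Definition perspective_tilde F (c : R) (r : R * R) : \bar R :=
  ereal_inf [set theta%:E * reverse_entropy F (r.1 / theta)%R
               + theta%:E * reverse_entropy F (r.2 / theta)%R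
               + theta%:E * c%:E
            | theta in [set theta : R | (0 < theta)%R]].

(* Only nonnegative costs c are relevant. *)
Definition perspective F (c : \bar R) (r : R * R) : \bar R :=
  match c with
  | c'%:E => lsc_envelope (@nneg R `*` @nneg R)
               (perspective_tilde F c') r
  | _ => F 0%R * r.1%:E + F 0%R * r.2%:E
  end.

End perspective.

(** * Cone over a metric space *)

Section cone.
Context (R : realType) (X : polishMetricType R).
Implicit Types z : X * {nonneg R}.

Definition cone_rel : rel (X * {nonneg R}) := fun z1 z2 =>
  ((z1.2%:num == 0) && (z2.2%:num == 0)) || (z1 == z2).

Lemma cone_rel_refl : reflexive cone_rel.
Proof. by move=> z; rewrite /cone_rel eqxx orbT. Qed.

Lemma cone_rel_sym : symmetric cone_rel.
Proof. by move=> z1 z2; rewrite /cone_rel andbC (eq_sym z1). Qed.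

Lemma cone_rel_trans : transitive cone_rel.
Proof.
move=> z2 z1 z3 /orP[/andP[r1 r2]|/eqP->//] /orP[/andP[_ r3]|/eqP<-].
- by rewrite /cone_rel r1 r3.
- by rewrite /cone_rel r1 r2.
Qed.

Canonical cone_equiv := EquivRel cone_rel cone_rel_refl cone_rel_sym
  cone_rel_trans.

Definition cone : Type := {eq_quot cone_equiv}%qT.

HB.instance Definition _ := Choice.on cone.
HB.instance Definition _ := EqQuotient.on cone.

Definition cone_class (x : X) (r : {nonneg R}) : cone :=
  (\pi_cone (x, r))%qT.

HB.instance Definition _ := isPointed.Build cone (cone_class point 0%:nng).

Definition cone_r (c : cone) : R := (repr c).2%:num.

Definition cone_x (xbar : X) (c : cone) : X :=
  if 0 < cone_r c then (repr c).1 else xbar.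

(* The cone metric; the choice of representatives only matters at the vertex,
   where the term containing the cosine vanishes. *)
Definition cone_dist (c c' : cone) : R :=
  Num.sqrt (cone_r c ^+ 2 + cone_r c' ^+ 2
    - 2 * cone_r c * cone_r c'
        * cos (Num.min (mdist (repr c).1 (repr c').1) pi)).

(* This is in general strictly coarser than the quotient topology. *)
Definition cone_open (U : set cone) : Prop :=
  forall c, U c -> exists2 e : R, 0 < e & forall c', cone_dist c c' < e -> U c'.

Lemma cone_openT : cone_open setT.
Proof. by move=> c _; exists 1. Qed.

Lemma cone_openI : setI_closed cone_open.
Proof.
move=> U V oU oV c [/oU[e e0 eU] /oV[f f0 fV]].
exists (Num.min e f); first by rewrite lt_min e0 f0.
by move=> c'; rewrite lt_min => /andP[/eU ? /fV ?].
Qed.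

Lemma cone_open_bigcup (I : Type) (U : I -> set cone) :
  (forall i, cone_open (U i)) -> cone_open (\bigcup_i U i).
Proof.
move=> oU c [i _ /oU[e e0 eU]]; exists e => // c' /eU ?.
by exists i.
Qed.

HB.instance Definition _ :=
  isOpenTopological.Build cone cone_openT cone_openI cone_open_bigcup.

End cone.

(** * Conic Gromov-Wasserstein functional *)

Section conic.
Local Open Scope ereal_scope.
Context (R : realType) (X1 X2 : polishMetricType R).
Variables (F l : R -> \bar R) (p : R) (x1 : X1) (x2 : X2).

Local Notation cone2 := (cone X1 * cone X2)%type.

Definition r1 (z : cone2) : R := cone_r z.1.
Definition r2 (z : cone2) : R := cone_r z.2.
Definition pos1 (z : cone2) : X1 := cone_x x1 z.1.
Definition pos2 (z : cone2) : X2 := cone_x x2 z.2.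

Definition hmarginal (X : polishMetricType R) (r : cone2 -> R) (pos : cone2 -> X)
    (alpha : fmeas R cone2) (A : set (borel X)) : \bar R :=
  \int[alpha]_(z in pos @^-1` A) ((r z) `^ p)%:E.

Definition conic_plans (mu1 : fmeas R X1) (mu2 : fmeas R X2) :
    set (fmeas R cone2) :=
  [set alpha |
    (forall A : set (borel X1), measurable A ->
       hmarginal r1 pos1 alpha A = mu1 A) /\
    (forall A : set (borel X2), measurable A ->
       hmarginal r2 pos2 alpha A = mu2 A)].

Definition conic_energy (alpha : fmeas R cone2) : \bar R :=
  \int[alpha]_z \int[alpha]_z'
    perspective F
      (l `|mdist (pos1 z) (pos1 z') - mdist (pos2 z) (pos2 z')|%R)
      (((r1 z * r1 z') `^ p)%R, ((r2 z * r2 z') `^ p)%R).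

Definition CGW (mu1 : fmeas R X1) (mu2 : fmeas R X2) : \bar R :=
  ereal_inf [set conic_energy alpha | alpha in conic_plans mu1 mu2].

End conic.

(* Main.v *)
(* The marginal perspective H is the Entropy-Transport cost of two Dirac masses.
   Applied to masses on the real line, the triangle inequality of D_ET says that,
   when delta <= d + d',
     H_(l delta)(rr', ss')^a <= r'^a H_(l d)(r, s)^a + s^a H_(l d')(r', s')^a,
   the middle mass being s r'. A transport plan gamma between the images of mu1
   and mu2 in a common space, with densities s1 and s2 of its marginals, lifts to a
   conic plan: gamma-almost every (u, v) is sent to ([u, s1(u)^(-1/p)], [v, s2(v)^(-1/p)])
   and the mass not transported, on {s1 = 0} and {s2 = 0}, is paired with the
   vertex. The integral of H over this plan is at most the cost of gamma. Since
   |d1(x, x') - d2(y, y')| <= d(x, y) + d(x', y'), the displayed inequality and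
   Minkowski's inequality in L^(1/a) bound the conic energy. *)

Require Import Defs.
From HB Require Import structures.
From mathcomp Require Import all_boot all_order all_algebra.
From mathcomp Require Import all_classical all_reals all_analysis.
From mathcomp Require Import measurable_realfun ring lra.

Set Implicit Arguments.
Unset Strict Implicit.
Unset Printing Implicit Defensive.

Import Order.TTheory GRing.Theory Num.Theory.
Import numFieldNormedType.Exports.

Local Open Scope classical_set_scope.
Local Open Scope ring_scope.

(** * Weights replacing Minkowski's inequality *)

(** The radius s^(-1/p) carries the mass 1/s, and F(s)/s integrated against the marginal s nu of
    gamma gives back F(s) integrated against nu on {s > 0}; the pairing with the vertex supplies the
    missing F(0) on {s = 0}. In the conic energy the factor r'^p integrates to mu1(X1) and s^p to
    mu2(X2), while the same plan cost remains in both terms: this is where mu1(X1)^a + mu2(X2)^a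
    comes from. The obstacle is that [perspective] is a lower semicontinuous envelope whose
    measurability in the double integral is not established, so Minkowski's inequality is not
    applied to it directly. It is dominated, at every pair of points, by explicit measurable costs
    with a prescribed transported mass theta, and the estimate P^a <= x^a + y^a is made linear in x
    and y by constant weights that depend on the two total masses only. *)

Section power_weights.
Context (R : realType).

(** Convexity of t^k with weights u/(u+v) and v/(u+v), at the points (u+v)/u x and (u+v)/v y, whose
    barycentre is x + y. *)
Lemma powR_add_le_weights (k u v x y : R) : 1 <= k -> 0 < u -> 0 < v ->
  0 <= x -> 0 <= y ->
  (x + y) `^ k <= ((u + v) / u) `^ (k - 1) * x `^ k
                + ((u + v) / v) `^ (k - 1) * y `^ k.
Proof.
move=> k1 u0 v0 x0 y0.
have uv0 : 0 < u + v by exact: addr_gt0.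
have k0 : 0 < k by exact: lt_le_trans k1.
have t01 : (0 <= u / (u + v) <= 1).
  apply/andP; split; first by rewrite divr_ge0// ltW.
  by rewrite ler_pdivrMr// mul1r lerDl ltW.
have := @convex_powR _ _ k1 (Itv01 (proj1 (andP t01)) (proj2 (andP t01)))
  ((u + v) / u * x) ((u + v) / v * y).
rewrite !inE /= !in_itv/= !andbT => H.
have {}H := H (mulr_ge0 (divr_ge0 (ltW uv0) (ltW u0)) x0)
         (mulr_ge0 (divr_ge0 (ltW uv0) (ltW v0)) y0).
move: H; rewrite [X in X `^ _ <= _ -> _]convRE convRE/= /unstable.onem.
have -> : u / (u + v) * ((u + v) / u * x) = x by field; rewrite !gt_eqF.
have -> : (1 - u / (u + v)) * ((u + v) / v * y) = y.
  by field; rewrite !gt_eqF.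
move=> /le_trans; apply.
have E w z : 0 < w -> 0 <= z ->
   w / (u + v) * (((u + v) / w * z) `^ k) = ((u + v) / w) `^ (k - 1) * z `^ k.
  move=> w0 z0; have q0 : 0 < (u + v) / w by exact: divr_gt0.
  rewrite powRM ?(ltW q0)// mulrA -(mulr_powRB1 (ltW q0) k0) mulrA.
  by rewrite -[w / _]invf_div mulVf ?mul1r// gt_eqF.
rewrite -(E u x)// -(E v y)//.
have -> : 1 - u / (u + v) = v / (u + v) by field; rewrite gt_eqF.
by [].
Qed.

Local Open Scope ereal_scope.

(* The weights of Minkowski's inequality in L^(1/a), which replace it: L1 and L2
   realise equality for functions of integrals M1 and M2. *)
Lemma poweR_add_le_weights (a M1 M2 : R) : (0 < a <= 1)%R ->
  (0 <= M1)%R -> (0 <= M2)%R ->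
  exists L1 L2 : \bar R, [/\ 0 <= L1, 0 <= L2,
    L1 * M1%:E + L2 * M2%:E <= ((M1 `^ a + M2 `^ a) `^ a^-1)%:E &
    forall P x y : \bar R, 0 <= P -> 0 <= x -> 0 <= y ->
      P `^ a <= x `^ a + y `^ a -> P <= L1 * x + L2 * y].
Proof.
move=> /andP[a0 a1] M10 M20.
have aN0 : (a != 0)%R by rewrite gt_eqF.
have k1 : (1 <= a^-1)%R by rewrite invf_ge1.
have k0 : (0 < a^-1)%R by rewrite invr_gt0.
have pK (z : \bar R) : 0 <= z -> (z `^ a) `^ a^-1 = z.
  by move=> z0; rewrite -poweRrM mulfV// poweRe1.
have pmono (P z : \bar R) : 0 <= P -> 0 <= z -> P `^ a <= z `^ a -> P <= z.
  move=> P0 z0 Pz; rewrite -(pK _ P0) -(pK _ z0).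
  by apply: (gt0_ler_poweR (ltW k0)) => //; rewrite in_itv/= poweR_ge0 leey.
have topl (L L' x y : \bar R) : 0 < L -> 0 <= L' -> 0 <= y ->
    x = +oo -> L * x + L' * y = +oo.
  move=> L0 L'0 y0 ->; rewrite gt0_muley// addye//.
  by rewrite gt_eqF// (@lt_le_trans _ _ 0)// mule_ge0.
have topl' (L' x y : \bar R) : 0 <= L' -> 0 <= y -> 0 < x ->
    +oo * x + L' * y = +oo.
  move=> L'0 y0 x0; rewrite gt0_mulye// addye//.
  by rewrite gt_eqF// (@lt_le_trans _ _ 0)// mule_ge0.
have pos (z : \bar R) : 0 <= z -> z != 0 -> 0 < z by rewrite lt_def => -> ->.
(* A vanishing mass gets the weight [+oo]: since [+oo * 0 = 0] the first bound is unaffected, and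
   the second is trivial unless the corresponding term x or y vanishes. *)
have [M1E|M1N] := eqVneq M1 0%R; have [M2E|M2N] := eqVneq M2 0%R.
- exists +oo, +oo; split => //.
    by rewrite M1E M2E !mule0 adde0 lee_fin powR_ge0.
  move=> P x y P0 x0 y0 H.
  have [xE|xN] := eqVneq x 0; have [yE|yN] := eqVneq y 0.
  + move: H; rewrite xE yE poweR0r// adde0 mule0 adde0 => H.
    by apply: pmono; rewrite ?poweR0r.
  + by rewrite addeC topl' ?leey ?pos.
  + by rewrite topl' ?leey ?pos.
  + by rewrite topl' ?leey ?pos.
- exists +oo, 1; split => //.
    rewrite M1E mule0 add0e mul1e powR0// add0r -powRrM mulfV// powRr1//.
  move=> P x y P0 x0 y0 H.
  have [xE|xN] := eqVneq x 0.
    by move: H; rewrite xE poweR0r// add0e mule0 add0e mul1e; exact: pmono.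
  by rewrite topl' ?leey ?pos.
- exists 1, +oo; split => //.
    rewrite M2E mule0 adde0 mul1e (powR0 aN0) addr0 -powRrM mulfV// powRr1//.
  move=> P x y P0 x0 y0 H.
  have [yE|yN] := eqVneq y 0.
    by move: H; rewrite yE poweR0r// adde0 mule0 adde0 mul1e; exact: pmono.
  by rewrite addeC topl' ?leey ?pos.
have u0 : (0 < M1 `^ a)%R by rewrite powR_gt0 // lt_def M1N.
have v0 : (0 < M2 `^ a)%R by rewrite powR_gt0 // lt_def M2N.
move uE : (M1 `^ a)%R u0 => u u0; move vE : (M2 `^ a)%R v0 => v v0.
have uv0 : (0 < u + v)%R by exact: addr_gt0.
have L0 w : (0 < w)%R -> (0 < ((u + v) / w) `^ (a^-1 - 1))%R.
  by move=> w0; rewrite powR_gt0// divr_gt0.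
(* With u = M1^a and v = M2^a, the products of weight and mass are (u+v)^(1/a-1) u and (u+v)^(1/a-1)
   v, whose sum is exactly (u+v)^(1/a). *)
exists (((u + v) / u) `^ (a^-1 - 1))%:E, (((u + v) / v) `^ (a^-1 - 1))%:E.
split; [by rewrite lee_fin ltW ?L0|by rewrite lee_fin ltW ?L0| |].
  have E w M : (0 <= M)%R -> w = (M `^ a)%R -> (0 < w)%R ->
     (((u + v) / w) `^ (a^-1 - 1) * M = (u + v) `^ (a^-1 - 1) * w)%R.
    move=> M0 wE w0; have -> : M = (w `^ (a^-1))%R.
      by rewrite wE -powRrM mulfV// powRr1.
    rewrite -(mulr_powRB1 (ltW w0) k0) powRM ?invr_ge0 ?(ltW w0) ?(ltW uv0)//.
    by rewrite mulrACA -powRM ?invr_ge0 ?(ltW w0)// mulVf ?powR1 ?mulr1// gt_eqF.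
  have : (((u + v) / u) `^ (a^-1 - 1) * M1 + ((u + v) / v) `^ (a^-1 - 1) * M2
      <= (u + v) `^ a^-1)%R.
    rewrite (E u M1)// (E v M2)//.
    by rewrite -mulrDr mulrC mulr_powRB1// ltW.
  by rewrite -lee_fin EFinD 2!EFinM.
move=> P x y P0 x0 y0 H.
have Lu : 0 < (((u + v) / u) `^ (a^-1 - 1))%:E by rewrite lte_fin L0.
have Lv : 0 < (((u + v) / v) `^ (a^-1 - 1))%:E by rewrite lte_fin L0.
have [xE|xN] := eqVneq x +oo; first by rewrite (topl _ _ _ _ Lu (ltW Lv))// leey.
have [yE|yN] := eqVneq y +oo.
  by rewrite addeC (topl _ _ _ _ Lv (ltW Lu))// leey.
move=> {topl topl' Lu Lv}.
move: x y x0 y0 xN yN H => [x||] [y||] //= x0 y0 _ _ H.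
have : P <= ((x `^ a + y `^ a) `^ a^-1)%:E.
  rewrite -(pK _ P0) -poweR_EFin.
  by apply: (gt0_ler_poweR (ltW k0)) => //;
    rewrite in_itv/= leey andbT ?poweR_ge0// lee_fin addr_ge0// powR_ge0.
move=> /le_trans; apply.
have := powR_add_le_weights k1 u0 v0 (powR_ge0 x a) (powR_ge0 y a).
by rewrite -!powRrM mulfV// !powRr1// -lee_fin EFinD 2!EFinM.
Qed.

End power_weights.

(** * Upper bounds on the marginal perspective *)

Section perspective_bounds.
Local Open Scope ereal_scope.
Context (R : realType) (F : R -> \bar R).
Hypothesis F_G0 : Gamma0 F.
Hypothesis F_superlinear : superlinear F.
Hypothesis F_fin : forall s, (0 <= s)%R -> F s \is a fin_num.

(* The cost of the plan of mass theta between Dirac masses r and s; when r = 0 and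
   theta = 0, the junk value F (theta / r) = F 0 is multiplied by 0. *)
Definition one_point_cost (theta r s : R) (c : \bar R) : \bar R :=
  r%:E * F (theta / r)%R + s%:E * F (theta / s)%R + theta%:E * c.

Let F_ge0 s : (0 <= s)%R -> 0 <= F s. Proof. by case: F_G0 => + _ _ _; exact. Qed.

Lemma one_point_cost_ge0 theta r s c : (0 <= theta)%R -> (0 <= r)%R ->
  (0 <= s)%R -> 0 <= c -> 0 <= one_point_cost theta r s c.
Proof.
by move=> *; rewrite !(adde_ge0, mule_ge0) ?lee_fin ?F_ge0 ?divr_ge0.
Qed.

Lemma le_one_point_cost theta r s c c' : (0 <= theta)%R -> c <= c' ->
  one_point_cost theta r s c <= one_point_cost theta r s c'.
Proof. by move=> t0 cc; rewrite leeD2l// lee_wpmul2l. Qed.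

Lemma one_point_costZ k theta r s c : (0 <= k)%R -> (0 <= theta)%R ->
  (0 <= r)%R -> (0 <= s)%R -> 0 <= c ->
  one_point_cost (k * theta) (k * r) (k * s) c
    = k%:E * one_point_cost theta r s c.
Proof.
move=> k0 t0 r0 s0 c0; have [->|kN0] := eqVneq k 0%R.
  by rewrite /one_point_cost !mul0r !mul0e !adde0.
rewrite /one_point_cost !ge0_muleDr ?adde_ge0 ?mule_ge0 ?lee_fin ?F_ge0 ?divr_ge0//.
by rewrite !EFinM !muleA -!mulf_div !divff// !mul1r.
Qed.

Lemma reverse_entropyE theta r : (0 < theta)%R -> (0 < r)%R ->
  theta%:E * reverse_entropy F (r / theta) = r%:E * F (theta / r)%R.
Proof.
move=> t0 r0; rewrite /reverse_entropy mulf_eq0 invr_eq0 !gt_eqF//=.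
by rewrite muleA -EFinM mulrCA divff ?gt_eqF// mulr1 invf_div.
Qed.

Lemma perspective_tilde_le theta r s c : (0 < theta)%R -> (0 < r)%R ->
  (0 < s)%R -> perspective_tilde F c (r, s) <= one_point_cost theta r s c%:E.
Proof.
move=> t0 r0 s0; apply: ereal_inf_lbound; exists theta => //=.
by rewrite !reverse_entropyE.
Qed.

(** Convexity of [F] between 1, where it vanishes, and 0. Enlarging a mass r by theta and
    transporting only theta costs no more than destroying r. *)
Lemma mul_F_shift_le theta r : (0 < theta)%R -> (0 <= r)%R ->
  (r + theta)%:E * F (theta / (r + theta))%R <= r%:E * F 0%R.
Proof.
move=> t0 r0; have rt0 : (0 < r + theta)%R by rewrite ltr_wpDl.
case: F_G0 => _ cvxF _ F1.
have t01 : (0 <= theta / (r + theta) <= 1)%R.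
  apply/andP; split; first by rewrite divr_ge0// ltW.
  by rewrite ler_pdivrMr// mul1r lerDr.
have := cvxF 1%R 0%R (theta / (r + theta))%R ler01 (lexx _) t01.
rewrite mulr0 mulr1 addr0 F1 mule0 add0e => H.
have : (r + theta)%:E * F (theta / (r + theta))%R <=
    (r + theta)%:E * ((1 - theta / (r + theta))%:E * F 0%R).
  by apply: lee_wpmul2l H; rewrite lee_fin ltW.
move=> /le_trans; apply; rewrite muleA -EFinM.
suff -> : ((r + theta) * (1 - theta / (r + theta)) = r)%R by [].
by field; rewrite gt_eqF.
Qed.

(** When r or s vanishes, [perspective_tilde] is infinite by superlinearity, and only the envelope
    is finite. A lower semicontinuous minorant exceeding the bound at (r, s) would still exceed it
    at (r + t, s + t) for small t, where transporting the mass t costs at most the bound plus t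
    c. *)
Lemma perspective_le_F0 r s c : (0 <= r)%R -> (0 <= s)%R -> 0 <= c ->
  perspective F c (r, s) <= F 0%R * r%:E + F 0%R * s%:E.
Proof.
move=> r0 s0; case: c => [c|//|//]; rewrite lee_fin => c0 /=.
apply: ge_ereal_sup => _ [g [lscg gle] <-].
have F0fin := F_fin (lexx 0%R).
rewrite leNgt; apply/negP => vg.
set v := F 0%R * _ + _ in vg.
have vfin : v \is a fin_num by rewrite fin_numD !fin_numM.
have [b vb bg] : exists2 b : R, v < b%:E & b%:E < g (r, s).
  move: vg; rewrite -(fineK vfin); case: (g (r, s)) => [w| |//].
    rewrite lte_fin => vw; exists ((fine v + w) / 2)%R; rewrite lte_fin.
      by rewrite midf_lt.
    by rewrite midf_lt.
  by move=> _; exists (fine v + 1)%R; rewrite ?ltry// lte_fin ltrDl.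
have [V nV Vg] := lscg _ _ bg.
have rsA : ((@nneg R) `*` (@nneg R)) (r, s) by [].
have : within (@nneg R `*` @nneg R) (nbhs (r, s)) V by rewrite nbhs_subspace_in.
move=> /nbhs_ballP[e /= e0 eV].
have bv0 : (0 < b - fine v)%R by rewrite subr_gt0 -lte_fin fineK.
have c10 : (0 < c + 1)%R by rewrite ltr_wpDl.
(* The first term keeps (r + t, s + t) in the neighbourhood, the second makes t c at most the gap
   [b - fine v]; [c + 1] is positive even when c = 0. *)
pose t := Num.min (e / 2)%R ((b - fine v) / (c + 1))%R.
have t0 : (0 < t)%R by rewrite lt_min !divr_gt0.
have te : (t < e)%R.
  by rewrite (@le_lt_trans _ _ (e / 2)%R) ?ge_min ?lexx// ltr_pdivrMr// ltr_pMr// ltr1n.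
have tb : (t * (c + 1) <= b - fine v)%R.
  by rewrite -ler_pdivlMr// ge_min lexx orbT.
have Vt : V (r + t, s + t)%R.
  apply: eV; last by split; rewrite /nneg/= addr_ge0// ltW.
  by split; rewrite /ball/= opprD addrA subrr sub0r normrN gtr0_norm.
have := Vg _ Vt; apply/negP; rewrite -leNgt.
have rt0 : (0 < r + t)%R by rewrite ltr_wpDl.
have st0 : (0 < s + t)%R by rewrite ltr_wpDl.
apply: (le_trans (gle _ _)); first by split; exact: ltW.
apply: (le_trans (perspective_tilde_le c t0 rt0 st0)).
apply: (@le_trans _ _ (v + (t * c)%:E)).
  rewrite /one_point_cost EFinM leeD2r// /v (muleC (F 0%R) r%:E) (muleC (F 0%R) s%:E).
  by apply: leeD; exact: mul_F_shift_le.
rewrite -(fineK vfin) -EFinD lee_fin; lra.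
Qed.

(** The condition on theta > 0 excludes transport to or from a zero mass: there [one_point_cost]
    would multiply the junk value [F 0] by 0 and miss the infinite cost of creating mass. *)
Lemma perspective_le_cost theta r s c c' : (0 <= theta)%R -> (0 <= r)%R ->
  (0 <= s)%R -> (0 < theta -> 0 < r /\ 0 < s)%R -> 0 <= c -> c <= c' ->
  perspective F c (r, s) <= one_point_cost theta r s c'.
Proof.
move=> t0 r0 s0 rs c0 cc; have [tE|tN0] := eqVneq theta 0%R.
  rewrite /one_point_cost tE !mul0r mul0e adde0 (muleC r%:E) (muleC s%:E).
  exact: perspective_le_F0.
have tp : (0 < theta)%R by rewrite lt_def tN0.
have [rp sp] := rs tp.
apply: le_trans (le_one_point_cost _ _ t0 cc).
case: c c0 {cc} => [c c0 /=|_|//].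
  apply: ge_ereal_sup => _ [g [_ gle] <-].
  exact: le_trans (gle _ _) (perspective_tilde_le c tp rp sp).
rewrite /one_point_cost gt0_muley ?lte_fin// addey ?leey//.
rewrite gt_eqF// (@lt_le_trans _ _ 0)// adde_ge0// mule_ge0 ?lee_fin// F_ge0//.
  exact: divr_ge0.
exact: divr_ge0.
Qed.

Lemma perspective_ge0 c r s : (0 <= r)%R -> (0 <= s)%R -> 0 <= c ->
  0 <= perspective F c (r, s).
Proof.
move=> r0 s0; case: c => [c|_|//]; last first.
  by rewrite /= adde_ge0// mule_ge0 ?lee_fin// F_ge0.
rewrite lee_fin => c0; apply: ereal_sup_ubound; exists (cst 0) => //; split.
  move=> x a a0; exists setT; first exact: filterT.
  by [].
move=> [x y] [/= x0 y0]; apply: le_ereal_inf_tmp => _ [t /= t0 <-].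
have rev0 z : (0 <= z)%R -> 0 <= reverse_entropy F z.
  move=> z0; rewrite /reverse_entropy; case: ifPn => [_|_]; last first.
    by rewrite mule_ge0 ?lee_fin// F_ge0// invr_ge0.
  by rewrite F_superlinear.
by rewrite !(adde_ge0, mule_ge0) ?lee_fin ?rev0 ?divr_ge0 ?(ltW t0).
Qed.

End perspective_bounds.

(** * Borel sets and Polish spaces *)

Section borel_measurability.
Context (T : ptopologicalType).

Lemma open_borel (A : set T) : open A -> measurable (A : set (borel T)).
Proof. exact: sub_sigma_algebra. Qed.

Lemma closed_borel (A : set T) : closed A -> measurable (A : set (borel T)).
Proof.
by move=> /closed_openC/open_borel/measurableC; rewrite setCK.
Qed.

Lemma measurable_fun_borelP d (W : measurableType d) (f : W -> T) :
  (forall A, open A -> measurable (f @^-1` A)) <->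
  measurable_fun setT (f : W -> borel T).
Proof.
split=> [mf|mf A oA].
  apply: (@measurability _ _ _ (borel T) _ _ (@open T)) => //.
  by move=> _ [A oA <-]; rewrite setTI; exact: mf.
by rewrite -[_ @^-1` _]setTI; apply: mf => //; exact: open_borel.
Qed.

End borel_measurability.

Section borel_maps.
Context (T U : ptopologicalType).

Lemma continuous_borel (f : T -> U) : continuous f ->
  measurable_fun setT (f : borel T -> borel U).
Proof.
move=> /continuousP cf.
apply/measurable_fun_borelP => A oA.
by apply: open_borel; exact: cf.
Qed.

(** Bridge between the sigma-algebra that [R] carries by itself and the open sets generating
    [borel R]; [measurable_cone_pair] passes from one to the other. *)
Lemma measurable_realP (R : realType) d (W : measurableType d) (f : W -> R) :
  (forall A : set R, open A -> measurable (f @^-1` A)) <->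
  measurable_fun setT f.
Proof.
split=> [mf|mf A oA].
  apply: (measurability _ (RGenOInfty.measurableE R)).
  by move=> _ [_ [a ->] <-]; rewrite setTI; apply: mf; exact: interval_open.
by rewrite -[_ @^-1` _]setTI; apply: mf => //; exact: open_measurable.
Qed.

Lemma continuous_borel_real (R : realType) (f : T -> R) : continuous f ->
  measurable_fun setT (f : borel T -> R).
Proof.
move=> /continuousP cf; apply/measurable_realP => A oA.
by apply: open_borel; exact: cf.
Qed.

(** Meant for the embedding of a support and for its inverse, each extended by a constant off a
    closed set: continuity is lost at the boundary, Borel measurability is not. *)
Lemma closed_extension_borel (S : set T) (f : T -> U) (u : U) : closed S ->
  {within S, continuous f} -> (forall x, ~ S x -> f x = u) ->
  measurable_fun setT (f : borel T -> borel U).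
Proof.
move=> cS /continuousP cf fu; apply/measurable_fun_borelP => A oA.
have /open_subspaceP[V oV VS] := cf _ oA.
have mS := closed_borel cS.
have -> : f @^-1` A = (V `&` S) `|` (~` S `&` [set x | A u]).
  rewrite VS; apply/seteqP; split => x /=.
    by have [Sx|Sx] := pselect (S x); [left|right; rewrite -(fu x)].
  by move=> [[]//|[Sx]]; rewrite (fu x).
apply: measurableU; first by apply: measurableI => //; exact: open_borel.
apply: measurableI; first exact: measurableC.
have [Au|Au] := pselect (A u).
  by rewrite (_ : [set _ | _] = setT)//; apply/seteqP; split.
by rewrite (_ : [set _ | _] = set0)//; apply/seteqP; split.
Qed.

End borel_maps.

(** Second countability makes an open set of a product a countable union of open rectangles. This is
    what measurability into [borel (T * U)], generated by all open sets of the product, requires of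
    a pair of measurable maps. *)
Definition countable_base (T : topologicalType) := exists B : nat -> set T,
  (forall n, open (B n)) /\
  forall (A : set T) x, open A -> A x -> exists2 n, B n x & B n `<=` A.

Lemma prod_countable_base (T U : topologicalType) :
  countable_base T -> countable_base U -> countable_base (T * U)%type.
Proof.
move=> [B [oB bB]] [C [oC bC]].
exists (fun n => if unpickle n is Some (i, j) then B i `*` C j else set0); split.
  move=> n; case: unpickle => [[i j]|]; last exact: open0.
  rewrite openE => -[x y] [/= Bx Cy]; exists (B i, C j) => //=.
  by split; apply: open_nbhs_nbhs; split.
move=> A [x y]; rewrite openE => oA /oA[[V W] /= [nV nW] VW].
move: nV nW; rewrite !nbhsE => -[V' [oV' V'x] V'V] [W' [oW' W'y] W'W].
have [i Bx BV] := bB _ _ oV' V'x; have [j Cy CW] := bC _ _ oW' W'y.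
exists (pickle (i, j)); rewrite pickleK//= => -[x' y'] [/= Bx' Cy'].
by apply: VW; split => /=; [apply/V'V/BV|apply/W'W/CW].
Qed.

Lemma polish_countable_base (R : realType) (X : polishMetricType R) :
  countable_base X.
Proof.
have [S /countable_injP[f finj] dS] := @separable_subproof R X.
(* [g] inverts the numbering [f] of the dense set; the base consists of the interiors of balls of
   radius 1/(m+1) centred at its values. *)
pose g k : X := get [set x | S x /\ f x = k].
exists (fun n => if unpickle n is Some (k, m) then (ball (g k) (m.+1%:R^-1 : R))^° else set0).
split.
  move=> n; case: unpickle => [[k m]|]; [exact: open_interior|exact: open0].
move=> A x; rewrite openE => oA /oA /nbhs_ballP[e /= e0 eA].
have [m me] : exists m, m.+1%:R^-1 < e / 2.
  near \oo => m; exists m; near: m.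
  by apply: near_infty_natSinv_lt (PosNum _); rewrite divr_gt0.
have m0 : 0 < m.+1%:R^-1 :> R by [].
have [y [By Sy]] : ((ball x (m.+1%:R^-1 : R))^° `&` S) !=set0.
  apply: dS; last exact: open_interior.
  by exists x; exact: nbhsx_ballx.
have gy : g (f y) = y.
  have [Sg fg] : [set z | S z /\ f z = f y] (g (f y)) by apply: getPex; exists y.
  by apply: finj; rewrite ?inE.
exists (pickle (f y, m)); rewrite pickleK /= gy.
  have /= := interior_subset By; rewrite ballEmdist /= metric_sym => yx.
  rewrite /interior.
  have d0 : 0 < m.+1%:R^-1 - mdist y x by rewrite subr_gt0.
  apply: filterS (nbhsx_ballx x _ d0) => z.
  rewrite !ballEmdist/= ltrBrDl; exact: le_lt_trans (metric_triangle _ _ _).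
move=> z /interior_subset; rewrite ballEmdist/= => yz.
apply: eA; rewrite ballEmdist/= (splitr e).
apply: le_lt_trans (metric_triangle x y z) _; apply: ltrD; last exact: lt_trans me.
by apply: lt_trans me; move: (interior_subset By); rewrite ballEmdist.
Unshelve. all: end_near. Qed.

Lemma real_separable (R : realType) :
  exists2 S : set R^o, countable S & dense S.
Proof.
exists (range (@ratr R)); last exact: dense_rat.
exact: card_le_trans (card_image_le _ _) (countableP _).
Qed.

Definition real_line (R : realType) : polishMetricType R :=
  HB.pack R^o (isSeparable.Build R^o (real_separable R)).

Lemma real_countable_base (R : realType) : countable_base R.
Proof. exact: (polish_countable_base (real_line R)). Qed.

Lemma measurable_pair_borel (T U : ptopologicalType) d (W : measurableType d)
    (f : W -> T) (g : W -> U) : countable_base T -> countable_base U ->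
  measurable_fun setT (f : W -> borel T) ->
  measurable_fun setT (g : W -> borel U) ->
  measurable_fun setT ((fun w => (f w, g w)) : W -> borel (T * U)%type).
Proof.
move=> [B [oB bB]] [C [oC bC]] /measurable_fun_borelP mf /measurable_fun_borelP mg.
apply/measurable_fun_borelP => A; rewrite openE => oA.
have -> : (fun w => (f w, g w)) @^-1` A =
    \bigcup_n \bigcup_(m in [set m | B n `*` C m `<=` A])
      (f @^-1` B n `&` g @^-1` C m).
  apply/seteqP; split => w /=; last first.
    by move=> [n _ [m nm [Bw Cw]]]; apply: nm.
  move=> /oA[[V V'] /= [+ +] VV]; rewrite !nbhsE.
  move=> [E [oE Ew] EV] [E' [oE' E'w] EV'].
  have [n Bn BE] := bB _ _ oE Ew; have [m Cm CE] := bC _ _ oE' E'w.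
  exists n => //; exists m => // -[x y] [/= Bx Cy].
  by apply: VV; split => /=; [apply/EV/BE|apply/EV'/CE].
apply: bigcupT_measurable => n; apply: bigcup_measurable => m _.
by apply: measurableI; [exact: mf|exact: mg].
Qed.

Lemma measurable_nneg (R : realType) : measurable (@nneg R).
Proof.
rewrite (_ : @nneg R = `[0, +oo[%classic)//.
by apply/seteqP; split => x /=; rewrite in_itv/= andbT.
Qed.

(** Sublevel sets of a convex function are intervals. Applied both to the entropy [F] and to the
    cost [l]. *)
Lemma convex_on_nonneg_measurable (R : realType) (f : R -> \bar R) :
  convex_on_nonneg f -> measurable_fun (@nneg R) f.
Proof.
move=> cf; apply: (measurability _ (ErealGenOInfty.measurableE R)).
move=> _ [_ [a ->] <-].
have mn := @measurable_nneg R.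
have -> : @nneg R `&` f @^-1` `]a%:E, +oo[%classic =
    @nneg R `\` (@nneg R `&` [set x | f x <= a%:E]%E).
  apply/seteqP; split => x /=; rewrite in_itv/= andbT.
    by move=> [x0 ax]; split => // -[_]; rewrite leNgt ax.
  move=> [x0 ax]; split => //; rewrite ltNge; apply/negP => fxa.
  exact: ax.
apply: measurableD => //; apply: is_interval_measurable.
move=> x y [/= x0 fx] [/= y0 fy] z /andP[xz zy].
have z0 : 0 <= z by exact: le_trans xz.
split => //=; have [xy|xy] := eqVneq x y.
  by have -> : z = x by apply/eqP; rewrite eq_le xz xy zy.
have xyp : 0 < y - x by rewrite subr_gt0 lt_neqAle xy (le_trans xz).
have t01 : 0 <= (y - z) / (y - x) <= 1.
  apply/andP; split; first by rewrite divr_ge0 ?(ltW xyp)// subr_ge0.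
  by rewrite ler_pdivrMr// mul1r lerD2l lerN2.
have := cf x y _ x0 y0 t01.
have -> : (y - z) / (y - x) * x + (1 - (y - z) / (y - x)) * y = z.
  by field; rewrite gt_eqF.
move: t01; set t := (_ / _)%R => /andP[t0 t1] /le_trans; apply.
apply: (@le_trans _ _ (t%:E * a%:E + (1 - t)%:E * a%:E)%E).
  by apply: leeD; apply: lee_wpmul2l; rewrite ?lee_fin ?subr_ge0.
by rewrite -EFinM -EFinM -EFinD -mulrDl subrKC mul1r.
Qed.

Lemma measurable_comp_nonneg (R : realType) (f : R -> \bar R) d
    (W : measurableType d) (g : W -> R) :
  measurable_fun (@nneg R) f -> measurable_fun setT g ->
  (forall w, 0 <= g w) -> measurable_fun setT (fun w => f (g w)).
Proof.
move=> mf mg g0.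
have mn := @measurable_nneg R.
by apply: (measurable_comp mn _ mf mg) => _ [w _ <-]; exact: g0.
Qed.

Section polish_space.
Context (R : realType) (X : polishMetricType R).

Lemma mdist_lipschitz (x x' y y' : X) :
  `|mdist x y - mdist x' y'| <= mdist x x' + mdist y y'.
Proof.
rewrite ler_norml; apply/andP; split.
  have := metric_triangle x' x y'; have := metric_triangle x y y'.
  by rewrite (metric_sym x' x); lra.
have := metric_triangle x x' y; have := metric_triangle x' y' y.
by rewrite (metric_sym y' y); lra.
Qed.

Lemma mdist_continuous : continuous (fun z : X * X => mdist z.1 z.2 : R).
Proof.
move=> [x y]; apply/cvgrPdist_lt => e e0.
have e20 : 0 < e / 2 by rewrite divr_gt0.
exists (ball x (e / 2), ball y (e / 2)) => /=; first by split; exact: nbhsx_ballx.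
move=> [x' y'] [/=]; rewrite !ballEmdist /= => xx yy.
by rewrite (le_lt_trans (mdist_lipschitz _ _ _ _))// (splitr e) ltrD.
Qed.

Lemma set1_borel (x : X) : measurable ([set x] : set (borel X)).
Proof.
apply: closed_borel; apply: accessible_closed_set1.
exact/hausdorff_accessible/metric_hausdorff.
Qed.

Lemma closed_supp (mu : fmeas R X) : closed (supp mu).
Proof.
rewrite -openC openE => x /existsNP[A] /not_implyP[oA] /not_implyP[Ax] mA.
apply: (@filterS _ _ _ A); last exact: open_nbhs_nbhs.
by move=> y Ay /(_ _ oA Ay).
Qed.

(** The complement of the support is a union of null open sets, which the countable base reduces to
    a countable union. *)
Lemma measure_supp (mu : fmeas R X) : mu (~` supp mu) = 0%E.
Proof.
have [B [oB bB]] := polish_countable_base X.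
have mB n : measurable (B n : set (borel X)) by exact: open_borel.
pose N n : set (borel X) := if mu (B n) == 0%E then B n else set0.
have mN n : measurable (N n) by rewrite /N; case: ifP.
apply: (@subset_measure0 _ _ _ mu _ (\bigcup_n N n)).
- by apply: measurableC; apply: closed_borel; exact: closed_supp.
- exact: bigcupT_measurable.
- move=> x /existsNP[A] /not_implyP[oA] /not_implyP[Ax] mA.
  have [n Bx BA] := bB _ _ oA Ax; exists n => //; rewrite /N ifT//.
  rewrite -measure_le0; apply: le_trans (le_measure mu _ _ BA) _.
  + by rewrite inE.
  + by rewrite inE; exact: open_borel.
  + by rewrite leNgt; apply/negP.
- apply: measure_negligible; first exact: bigcupT_measurable.
  apply: negligible_bigcup => n; apply/negligibleP => //; rewrite /N.
  by case: ifPn => [/eqP//|_]; rewrite measure0.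
Qed.

End polish_space.

(** * Transport between Dirac masses *)

(* The library instance depends on [mf], which inference cannot supply. *)
Definition image_measure d d' (T : measurableType d) (T' : measurableType d')
    (R : realType) (m : {measure set T -> \bar R}) (f : T -> T')
    (mf : measurable_fun setT f) : {measure set T' -> \bar R} :=
  measure_function_pushforward__canonical__measure_function_Measure m mf.

Section dirac_transport.
Local Open Scope ereal_scope.
Context (R : realType).
Variables (F : R -> \bar R).
Hypothesis F_G0 : Gamma0 F.
Hypothesis F_superlinear : superlinear F.
Hypothesis F_fin : forall s, (0 <= s)%R -> F s \is a fin_num.

Let F_ge0 s : (0 <= s)%R -> 0 <= F s. Proof. by case: F_G0 => + _ _ _; exact. Qed.

Definition scaled_dirac (T : ptopologicalType) (r : {nonneg R}) (x : T) :
    fmeas R T :=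
  [the {finite_measure set (borel T) -> \bar R} of mscale r (dirac (x : borel T))].

Lemma integral_scaled_dirac (T : ptopologicalType) (r : {nonneg R}) (x : T)
    (A : set (borel T)) (f : T -> \bar R) : measurable A ->
  measurable_fun setT (f : borel T -> \bar R) -> (forall y, 0 <= f y) ->
  \int[scaled_dirac r x]_(y in A) f y = (r%:num * \1_A x)%:E * f x.
Proof.
move=> mA mf f0; rewrite ge0_integral_mscale//; last exact: measurable_funTS.
by rewrite integral_dirac// ?EFinM ?muleA//; exact: measurable_funTS.
Qed.

Lemma divergence_ge0 d (T : measurableType d) (g : set T -> \bar R)
    (mu : {measure set T -> \bar R}) : 0 <= divergence F g mu.
Proof.
apply: le_ereal_inf_tmp => _ [s [gp [[_ s0 _ _] ->]]].
rewrite adde_ge0//; first by apply: integral_ge0 => x _; exact: F_ge0.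
by rewrite mule_ge0// F_superlinear.
Qed.

(** A singular part would be charged the infinite recession constant, so a finite divergence forces
    absolute continuity. *)
Lemma divergence_lty d (T : measurableType d) (g : set T -> \bar R)
    (mu : {measure set T -> \bar R}) (v : \bar R) :
  divergence F g mu < v ->
  exists s : T -> R, [/\ measurable_fun setT s, forall x, (0 <= s x)%R,
    forall A, measurable A -> g A = \int[mu]_(x in A) (s x)%:E &
    \int[mu]_x F (s x) < v].
Proof.
move=> /ereal_inf_lt[_ [s [gp [[ms s0 _ gE] ->]]] lt_v].
have gp0 : gp setT = 0.
  apply/eqP/negPn/negP => gpN0; move: lt_v.
  rewrite F_superlinear gt0_mulye; last by rewrite lt_def gpN0 measure_ge0.
  rewrite addey ?ltNge ?leey//.
  by rewrite gt_eqF// (@lt_le_trans _ _ 0)//; apply: integral_ge0 => x _; exact: F_ge0.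
exists s; split => //.
  move=> A mA; rewrite gE// (_ : gp A = 0) ?adde0//.
  exact: (@subset_measure0 _ _ _ gp A setT).
by move: lt_v; rewrite gp0 mule0 adde0.
Qed.

Lemma divergence_dirac_le (T : ptopologicalType) (g : set (borel T) -> \bar R)
    (theta : R) (r : {nonneg R}) (x : T) :
  (0 <= theta)%R -> (0 < theta -> 0 < r%:num)%R ->
  (forall A, measurable A -> g A = (theta * \1_A x)%:E) ->
  divergence F g (scaled_dirac r x) <= r%:num%:E * F (theta / r%:num)%R.
Proof.
move=> t0 tr gE; apply: ereal_inf_lbound.
have q0 : (0 <= theta / r%:num)%R by rewrite divr_ge0.
exists (cst (theta / r%:num)%R), mzero; split.
  split => //.
    by exists set0 => //; split; rewrite // measure0.
  move=> A mA; rewrite gE// integral_scaled_dirac//; last exact/measurable_EFinP/measurable_cst.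
  rewrite [RHS](_ : _ = (r%:num * \1_A x * (theta / r%:num))%:E); last first.
    by rewrite /= /mzero adde0.
  congr (_%:E); have [->|tN0] := eqVneq theta 0%R; first by rewrite !mul0r mulr0.
  have r0 : (0 < r%:num)%R by apply: tr; rewrite lt_def tN0.
  by field; rewrite gt_eqF.
rewrite integral_scaled_dirac//; last 2 first.
- exact: (measurable_cst (F _)).
- by move=> y; exact: F_ge0.
by rewrite indicT mulr1 /= /mzero mule0 adde0.
Qed.

Lemma divergence_dirac_lty (T : ptopologicalType) (g : {measure set (borel T) -> \bar R})
    (r : {nonneg R}) (x : T) : measurable ([set x] : set (borel T)) ->
    measurable_fun (@nneg R) F ->
  divergence F g (scaled_dirac r x) < +oo ->
  exists theta : R, [/\ (0 <= theta)%R, (0 < theta -> 0 < r%:num)%R,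
  forall A, measurable A -> g A = (theta * \1_A x)%:E &
  r%:num%:E * F (theta / r%:num)%R <= divergence F g (scaled_dirac r x)].
Proof.
move=> mx mF Dy.
have gE (s : T -> R) : measurable_fun setT (s : borel T -> R) -> (forall x, 0 <= s x)%R ->
    (forall A, measurable A -> g A = \int[scaled_dirac r x]_(x in A) (s x)%:E) ->
    forall A, measurable A -> g A = (r%:num * s x * \1_A x)%:E.
  move=> ms s0 gs A mA; rewrite gs// integral_scaled_dirac//.
  - by rewrite -EFinM mulrAC.
  - exact/measurable_EFinP.
have [s [ms s0 gs _]] := divergence_lty Dy.
exists (r%:num * s x)%R; split.
- by rewrite mulr_ge0.
- by rewrite !lt_def => /andP[]; rewrite mulf_eq0 negb_or => /andP[-> _] _ /=.
- exact: gE.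
(* Any other density gives the same total mass, hence the same value at x when r > 0: no
   decomposition does better than [s]. *)
rewrite leNgt; apply/negP => /divergence_lty[s' [ms' s'0 gs']].
rewrite integral_scaled_dirac//; last 2 first.
- exact: measurable_comp_nonneg.
- by move=> y; exact: F_ge0.
rewrite indicT mulr1.
have [r0|rN0] := eqVneq r%:num 0%R; first by rewrite r0 !mul0e ltxx.
have := gE _ ms' s'0 gs' setT measurableT; rewrite (gE _ ms s0 gs setT measurableT).
rewrite !indicT !mulr1 => -[] /(mulfI rN0) ->.
by rewrite mulrAC divff// mul1r ltxx.
Qed.

Section polish.
Variables (X : polishMetricType R) (c : X * X -> \bar R).
Hypothesis mc : measurable_fun setT (c : borel (X * X)%type -> \bar R).
Hypothesis c0 : forall z, 0 <= c z.

Lemma ET_dirac_le (theta : R) (r s : {nonneg R}) (x y : X) : (0 <= theta)%R ->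
  (0 < theta -> 0 < r%:num /\ 0 < s%:num)%R ->
  ET F c (scaled_dirac r x) (scaled_dirac s y)
    <= one_point_cost F theta r%:num s%:num (c (x, y)).
Proof.
move=> t0 trs; pose g : fmeas R (X * X)%type := scaled_dirac (NngNum t0) (x, y).
apply: le_trans (ereal_inf_lbound _) _; first by exists g.
apply: leeD; first apply: leeD.
- by apply: divergence_dirac_le => // /trs[].
- by apply: divergence_dirac_le => // /trs[].
- by rewrite integral_scaled_dirac// indicT mulr1.
Qed.

(** A plan with finite divergences from two Dirac masses has marginals concentrated at x and at y,
    so it is a multiple theta of the Dirac mass at (x, y), and its cost is at least the
    corresponding [one_point_cost]. *)
Lemma perspective_le_ET (k : \bar R) (r s : {nonneg R}) (x y : X) :
  measurable_fun (@nneg R) F -> 0 <= k -> k <= c (x, y) ->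
  perspective F k (r%:num, s%:num)
    <= ET F c (scaled_dirac r x) (scaled_dirac s y).
Proof.
move=> mF k0 kc; apply: le_ereal_inf_tmp => _ [g _ <-].
have mfst : measurable_fun setT (fst : borel (X * X)%type -> borel X).
  by apply: continuous_borel => z; exact: cvg_fst.
have msnd : measurable_fun setT (snd : borel (X * X)%type -> borel X).
  by apply: continuous_borel => z; exact: cvg_snd.
set D1 := divergence _ _ _; set D2 := divergence _ _ _; set C := integral _ _ _.
have C0 : 0 <= C by exact: integral_ge0.
have D10 : 0 <= D1 by exact: divergence_ge0.
have D20 : 0 <= D2 by exact: divergence_ge0.
have [D1y|] := ltP D1 +oo; last first.
  rewrite leye_eq => /eqP ->; rewrite -addeA addye ?leey//.
  by rewrite gt_eqF// (@lt_le_trans _ _ 0)// adde_ge0.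
have [D2y|] := ltP D2 +oo; last first.
  rewrite leye_eq => /eqP ->; rewrite addeAC addey ?leey//.
  by rewrite gt_eqF// (@lt_le_trans _ _ 0)// adde_ge0.
have [t [t0 tr g1E tD1]] := divergence_dirac_lty (set1_borel x) mF
  (D1y : divergence F (image_measure g mfst) _ < +oo).
have [t' [t'0 ts g2E tD2]] := divergence_dirac_lty (set1_borel y) mF
  (D2y : divergence F (image_measure g msnd) _ < +oo).
have tt' : t = t'.
  have := g1E _ measurableT; rewrite /= /pushforward preimage_setT.
  have := g2E _ measurableT; rewrite /= /pushforward preimage_setT.
  by move=> ->; rewrite !indicT !mulr1 => -[].
subst t'.
have mxy : measurable ([set (x, y)] : set (borel (X * X)%type)).
  rewrite (_ : [set _] = fst @^-1` [set x] `&` snd @^-1` [set y]).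
    apply: measurableI; rewrite -[_ @^-1` _]setTI.
      exact: (mfst measurableT _ (set1_borel x)).
    exact: (msnd measurableT _ (set1_borel y)).
  by apply/seteqP; split => [_ ->|[? ?] [/= -> ->]].
have gxy : g [set (x, y)] = t%:E.
  have := g1E _ measurableT; rewrite indicT mulr1 /= /pushforward preimage_setT => <-.
  rewrite -(setvU [set (x, y)]) measureU//; last 2 first.
    exact: measurableC.
    exact: setICl.
  rewrite [X in _ = X + _](_ : _ = 0) ?add0e//; apply: measure_negligible.
    exact: measurableC.
  have n1 : g.-negligible (fst @^-1` (~` [set x])).
    apply/negligibleP; first by rewrite -[_ @^-1` _]setTI;
      exact: (mfst measurableT _ (measurableC (set1_borel x))).
    have := g1E _ (measurableC (set1_borel x)).
    by rewrite /= /pushforward indicE memNset ?mulr0//; exact.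
  have n2 : g.-negligible (snd @^-1` (~` [set y])).
    apply/negligibleP; first by rewrite -[_ @^-1` _]setTI;
      exact: (msnd measurableT _ (measurableC (set1_borel y))).
    have := g2E _ (measurableC (set1_borel y)).
    by rewrite /= /pushforward indicE memNset ?mulr0//; exact.
  apply: negligibleS (negligibleU n1 n2) => -[x' y'] /= xy.
  have [xx|] := pselect (x' = x); last by left.
  by right => yy; apply: xy; rewrite xx yy.
apply: (@le_trans _ _ (one_point_cost F t r%:num s%:num (c (x, y)))).
  by apply: perspective_le_cost => // t1; split; [exact: tr|exact: ts].
apply: leeD; first exact: leeD.
rewrite /C -gxy muleC -integral_cst//.
rewrite (eq_integral (c : borel (X * X)%type -> \bar R)); last by move=> z; rewrite inE => ->.
exact: ge0_subset_integral.
Qed.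

End polish.

End dirac_transport.

(** * Triangle inequality for the marginal perspective *)

Section perspective_triangle.
Local Open Scope ereal_scope.
Context (R : realType) (a : R) (F l : R -> \bar R).
Hypothesis hET : regular_ET a F l.

(** Convexity on the segment from 0, where [l] vanishes, to y, together with [l] nonnegative. *)
Lemma regular_ET_cost_nondecreasing x y : (0 <= x)%R -> (x <= y)%R ->
  l x <= l y.
Proof.
move=> x0 xy; have [_ _ [l0 _ cl lz] _] := hET.
have [yE|yN] := eqVneq y 0%R.
  by have -> : x = y by apply/eqP; rewrite eq_le xy yE x0.
have y0 : (0 < y)%R by rewrite lt_def yN (le_trans x0).
have t01 : (0 <= x / y <= 1)%R.
  apply/andP; split; first by rewrite divr_ge0// ltW.
  by rewrite ler_pdivrMr// mul1r.
have := cl y 0%R (x / y)%R (ltW y0) (lexx _) t01.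
rewrite mulr0 addr0 divfK// (proj2 (lz 0%R (lexx _)) erefl) mule0 adde0.
move=> /le_trans; apply; rewrite -[leRHS]mul1e.
by apply: lee_wpmul2r; [apply: l0; exact: ltW|rewrite lee_fin; case/andP: t01].
Qed.

Lemma measurable_regular_ET_cost (X : polishMetricType R) :
  measurable_fun setT ((fun z => l (mdist z.1 z.2)) : borel (X * X)%type -> \bar R).
Proof.
have [_ _ [_ _ cl _] _] := hET.
apply: measurable_comp_nonneg; first exact: convex_on_nonneg_measurable.
  by apply: continuous_borel_real; exact: mdist_continuous.
by move=> w; exact: mdist_ge0.
Qed.

Lemma measurable_regular_ET_entropy : measurable_fun (@nneg R) F.
Proof.
by have [_ [[_ cF _ _] _ _] _ _] := hET; exact: convex_on_nonneg_measurable.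
Qed.

(* ET of two Dirac masses on the real line is the marginal perspective cost, so
   that the triangle inequality of D_ET on the line passes to the latter. *)
Lemma perspective_triangle (r t s : {nonneg R}) (th th' D D' delta : R) :
  (0 <= th)%R -> (0 < th -> 0 < r%:num /\ 0 < t%:num)%R ->
  (0 <= th')%R -> (0 < th' -> 0 < t%:num /\ 0 < s%:num)%R ->
  (0 <= D)%R -> (0 <= D')%R -> (0 <= delta)%R -> (delta <= D + D')%R ->
  perspective F (l delta) (r%:num, s%:num) `^ a
    <= one_point_cost F th r%:num t%:num (l D) `^ a
     + one_point_cost F th' t%:num s%:num (l D') `^ a.
Proof.
move=> th0 thrt th'0 thts D0 D'0 d0 dD.
have [/andP[a0 a1] [FG0 Fsup Ffin] [l0 _ _ _] /(_ (real_line R))[[_ _ _ tri] _ _ _]] := hET.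
have mc := @measurable_regular_ET_cost (real_line R).
have mF := measurable_regular_ET_entropy.
have c0 (z : real_line R * real_line R) : 0 <= l (mdist z.1 z.2).
  by apply: l0; exact: mdist_ge0.
(* On the line the points 0, D, D + D' make the outer distance exactly D + D', which dominates
   delta; [l] being nondecreasing, the outer transport cost dominates [l delta]. *)
pose x0 : real_line R := 0%R : R; pose x1 : real_line R := D.
pose x2 : real_line R := (D + D')%R.
have E01 : mdist x0 x1 = D.
  by rewrite /mdist /= subr0 ger0_norm.
have E12 : mdist x1 x2 = D'.
  by rewrite /mdist /= /x2 /x1 addrC addKr ger0_norm.
have E02 : mdist x0 x2 = (D + D')%R.
  by rewrite /mdist /= subr0 ger0_norm// addr_ge0.
have pos (z : \bar R) : 0 <= z -> z \in `[0, +oo].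
  by move=> z0; rewrite in_itv/= z0 leey.
have C0 : 0 <= one_point_cost F th r%:num t%:num (l D) by rewrite one_point_cost_ge0// l0.
have C1 : 0 <= one_point_cost F th' t%:num s%:num (l D') by rewrite one_point_cost_ge0// l0.
have ET0 (mu nu : fmeas R (real_line R)) :
    0 <= ET F (fun z : real_line R * real_line R => l (mdist z.1 z.2)) mu nu.
  apply: le_ereal_inf_tmp => _ [g _ <-].
  by apply: adde_ge0; [apply: adde_ge0; exact: divergence_ge0|exact: integral_ge0].
apply: (@le_trans _ _ (ET_dist a F l (scaled_dirac r x0) (scaled_dirac s x2))).
  apply: (gt0_ler_poweR (ltW a0)); rewrite ?pos ?perspective_ge0 ?l0//.
  apply: perspective_le_ET => //; first exact: l0.
  by rewrite /= E02; exact: regular_ET_cost_nondecreasing.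
apply: (le_trans (tri _ (scaled_dirac t x1) _)); apply: leeD.
  apply: (gt0_ler_poweR (ltW a0)); rewrite ?pos//.
  by rewrite -E01; exact: ET_dirac_le.
apply: (gt0_ler_poweR (ltW a0)); rewrite ?pos//.
by rewrite -E12; exact: ET_dirac_le.
Qed.

(** The distances D and D' have to be real numbers, as coordinates on the line; the separate bounds
    h and h' leave room for costs that may be infinite, such as [plan_cost]. *)
Lemma perspective_product_le (r s r' s' th th' D D' delta : R) (h h' : \bar R) :
  (0 <= r)%R -> (0 <= s)%R -> (0 <= r')%R -> (0 <= s')%R ->
  (0 <= th)%R -> (0 < th -> 0 < r /\ 0 < s)%R ->
  (0 <= th')%R -> (0 < th' -> 0 < r' /\ 0 < s')%R ->
  (0 <= D)%R -> (0 <= D')%R -> (0 <= delta)%R -> (delta <= D + D')%R ->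
  one_point_cost F th r s (l D) <= h -> one_point_cost F th' r' s' (l D') <= h' ->
  perspective F (l delta) (r * r', s * s')%R `^ a
    <= (r'%:E * h) `^ a + (s%:E * h') `^ a.
Proof.
move=> r0 s0 r'0 s'0 th0 thrs th'0 thrs' D0 D'0 d0 dD hh hh'.
have [/andP[a0 a1] [FG0 _ _] [l0 _ _ _] _] := hET.
have gt0 (x y : R) : (0 <= x -> 0 <= y -> 0 < x * y -> 0 < x /\ 0 < y)%R.
  rewrite !le0r => /orP[/eqP->|x0] /orP[/eqP->|y0]; rewrite ?mul0r ?mulr0 ?ltxx//.
(* By homogeneity, r' times the plan from r to s leads from r r' to the middle mass s r', and s
   times the plan from r' to s' leads on to s s'. *)
pose R1 := NngNum (mulr_ge0 r'0 r0); pose T1 := NngNum (mulr_ge0 r'0 s0).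
pose S1 := NngNum (mulr_ge0 s0 s'0).
have := @perspective_triangle R1 T1 S1 (r' * th)%R (s * th')%R D D' delta.
rewrite /= (mulrC r' r) => H; apply: (le_trans (H _ _ _ _ _ _ _ _)) => //.
- exact: mulr_ge0.
- move=> /(gt0 _ _ r'0 th0)[r'p thp]; have [rp sp] := thrs thp.
  by split; exact: mulr_gt0.
- exact: mulr_ge0.
- move=> /(gt0 _ _ s0 th'0)[sp thp]; have [rp s'p] := thrs' thp.
  by split; exact: mulr_gt0.
have pos (z : \bar R) : 0 <= z -> z \in `[0, +oo].
  by move=> z0; rewrite in_itv/= z0 leey.
have C0 : 0 <= one_point_cost F th r s (l D) by rewrite one_point_cost_ge0// l0.
have C1 : 0 <= one_point_cost F th' r' s' (l D') by rewrite one_point_cost_ge0// l0.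
apply: leeD.
  rewrite (mulrC r r') one_point_costZ ?l0//.
  apply: (gt0_ler_poweR (ltW a0)); rewrite ?pos ?mule_ge0 ?lee_fin// ?(le_trans C0)//.
  by apply: lee_wpmul2l.
rewrite (mulrC r' s) one_point_costZ ?l0//.
apply: (gt0_ler_poweR (ltW a0)); rewrite ?pos ?mule_ge0 ?lee_fin// ?(le_trans C1)//.
by apply: lee_wpmul2l.
Qed.

End perspective_triangle.

(** * Cones *)

Section cone_maps.
Context (R : realType) (X : polishMetricType R).

Lemma cone_r_class (x : X) (r : {nonneg R}) : cone_r (cone_class x r) = r%:num.
Proof.
rewrite /cone_r; have /eqmodP : (repr (cone_class x r) = (x, r) %[mod cone X])%qT.
  by rewrite reprK.
by move=> /orP[/andP[/eqP -> /eqP /= ->]|/eqP ->].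
Qed.

Lemma cone_repr_class (x : X) (r : {nonneg R}) : 0 < r%:num ->
  (repr (cone_class x r)).1 = x.
Proof.
move=> r0; have /eqmodP : (repr (cone_class x r) = (x, r) %[mod cone X])%qT.
  by rewrite reprK.
by move=> /orP[/andP[_ /eqP rE]|/eqP ->//]; move: r0; rewrite rE ltxx.
Qed.

Lemma cone_x_class (xbar x : X) (r : {nonneg R}) :
  cone_x xbar (cone_class x r) = if 0 < r%:num then x else xbar.
Proof. by rewrite /cone_x cone_r_class; case: ifPn => // /cone_repr_class. Qed.

Lemma cone_r_ge0 (c : cone X) : 0 <= cone_r c.
Proof. by rewrite /cone_r. Qed.

(** As a sum of a radial and an angular term, both nonnegative, so that each bounds the distance
    from below. *)
Lemma cone_distE (c c' : cone X) : cone_dist c c' =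
  Num.sqrt ((cone_r c - cone_r c') ^+ 2 + 2 * cone_r c * cone_r c'
      * (1 - cos (Num.min (mdist (repr c).1 (repr c').1) pi))).
Proof. by rewrite /cone_dist; congr Num.sqrt; ring. Qed.

Lemma cone_dist_class (x x' : X) (r r' : {nonneg R}) :
  cone_dist (cone_class x r) (cone_class x' r') =
  Num.sqrt ((r%:num - r'%:num) ^+ 2 + 2 * r%:num * r'%:num
      * (1 - cos (Num.min (mdist x x') pi))).
Proof.
rewrite cone_distE !cone_r_class; congr (Num.sqrt (_ + _)).
have [rE|rN] := eqVneq r%:num 0; first by rewrite rE mulr0 !mul0r.
have [r'E|r'N] := eqVneq r'%:num 0; first by rewrite r'E mulr0 !mul0r.
by rewrite !cone_repr_class// lt_def ?rN ?r'N /=.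
Qed.

Lemma cone_dist_ge_r (c c' : cone X) : `|cone_r c - cone_r c'| <= cone_dist c c'.
Proof.
rewrite -sqrtr_sqr cone_distE; apply: ler_wsqrtr; rewrite lerDl.
by rewrite !mulr_ge0 ?cone_r_ge0// subr_ge0 cos_le1.
Qed.

Lemma open_coneP (U : set (cone X)) : open U <-> cone_open U.
Proof. by []. Qed.

Lemma cone_open_r (A : set R) : open A -> open (@cone_r R X @^-1` A).
Proof.
move=> oA; apply/open_coneP => c Ac; move: oA; rewrite openE => /(_ _ Ac)/nbhs_ballP[e /= e0 eA].
by exists e => // c' cc'; apply: eA; exact: le_lt_trans (cone_dist_ge_r _ _) cc'.
Qed.

Lemma cone_open_x (xbar : X) (A : set X) : open A ->
  open [set c : cone X | 0 < cone_r c /\ A (cone_x xbar c)].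
Proof.
move=> oA; apply/open_coneP => c [/= r0]; rewrite /cone_x r0 => Ac.
move: oA; rewrite openE => /(_ _ Ac)/nbhs_ballP[e /= e0 eA].
(* The cap at pi matches the cone metric and stays where the cosine is decreasing. *)
pose e' := Num.min e pi.
have e'0 : 0 < e' by rewrite lt_min e0 pi_gt0.
have e'pi : e' <= pi by rewrite ge_min lexx orbT.
pose k := 1 - cos e'.
have k0 : 0 < k.
  rewrite subr_gt0 -[X in _ < X]cos0 ltr_cos// in_itv/= ?lexx ?pi_ge0//.
  by rewrite (ltW e'0).
(* The first bound gives r' >= r/2, hence 2 r r' >= r^2. A displacement of at least e would then
   make the angular term at least r^2 k, contradicting the second bound. *)
exists (Num.min (cone_r c / 2) (cone_r c * Num.sqrt k)).
  by rewrite lt_min divr_gt0// mulr_gt0// sqrtr_gt0.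
move=> c'; rewrite lt_min => /andP[c1 c2].
have r'h : cone_r c / 2 <= cone_r c'.
  have := le_lt_trans (cone_dist_ge_r c c') c1; rewrite ltr_norml => /andP[]; lra.
have r'0 : 0 < cone_r c' by apply: lt_le_trans r'h; rewrite divr_gt0.
split => //; rewrite r'0; apply: eA; rewrite ballEmdist /= ltNge.
apply/negP => ed; move: c2; apply/negP; rewrite -leNgt cone_distE.
rewrite -[X in X * _]gtr0_norm// -sqrtr_sqr -sqrtrM ?sqr_ge0//.
apply: ler_wsqrtr; rewrite -[leLHS]add0r lerD ?sqr_ge0//.
apply: ler_pM; rewrite ?sqr_ge0 ?(ltW k0)//.
  by have := ler_wpM2l (ltW r0) r'h; rewrite expr2; lra.
rewrite lerD2l lerN2; set m := Num.min _ _.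
have e'm : e' <= m by rewrite le_min e'pi andbT ge_min ed.
have mpi : m <= pi by rewrite ge_min lexx orbT.
rewrite leNgt ltr_cos ?in_itv/= ?mpi ?e'pi ?(ltW e'0)// ?(le_trans _ e'm) ?ltW//.
by rewrite -leNgt.
Qed.

Lemma measurable_cone_r : measurable_fun setT (@cone_r R X : borel (cone X) -> R).
Proof.
by apply/measurable_realP => A oA; apply: open_borel; exact: cone_open_r.
Qed.

(** The position is continuous off the vertex and takes the single value [xbar] at it. *)
Lemma measurable_cone_x (xbar : X) :
  measurable_fun setT (cone_x xbar : borel (cone X) -> borel X).
Proof.
apply/measurable_fun_borelP => A oA.
have m0 : measurable (@cone_r R X @^-1` [set 0] : set (borel (cone X))).
  by rewrite -[_ @^-1` _]setTI; exact: measurable_cone_r.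
rewrite (_ : _ @^-1` _ = [set c : cone X | 0 < cone_r c /\ A (cone_x xbar c)]
    `|` (@cone_r R X @^-1` [set 0] `&` [set _ | A xbar])); last first.
  apply/seteqP; split => c /=.
    rewrite /cone_x; case: ifPn => r0 Ac; [by left|right; split => //].
    by apply/eqP; rewrite eq_le cone_r_ge0 leNgt r0.
  by move=> [[]//|[rE]]; rewrite /cone_x rE ltxx.
apply: measurableU; first by apply: open_borel; exact: cone_open_x.
apply: measurableI => //.
have [Ax|Ax] := pselect (A xbar).
  by rewrite (_ : [set _ | _] = setT)//; apply/seteqP; split.
by rewrite (_ : [set _ | _] = set0)//; apply/seteqP; split.
Qed.

(* Only r >= 0 matters; the absolute value gives a continuous map on X * R. *)
Definition cone_point (z : X * R) : cone X := cone_class z.1 (NngNum (normr_ge0 z.2)).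

Lemma cone_point_continuous : continuous cone_point.
Proof.
move=> [x r]; have r0 : 0 <= `|r| by [].
(* [g z] is the cone distance from the class of (x, r) to that of z; it is continuous and vanishes
   at (x, r), also when (x, r) is sent to the vertex. *)
pose g (z : X * R) : R := Num.sqrt ((`|r| - `|z.2|) ^+ 2 + 2 * `|r| * `|z.2|
      * (1 - cos (Num.min (mdist x z.1) pi))).
have g0 : g (x, r) = 0.
  by rewrite /g /= subrr mdistxx min_l ?pi_ge0// cos0 subrr mulr0 expr0n addr0 sqrtr0.
have cg : {for (x, r), continuous g}.
  apply: (continuous_comp (g := Num.sqrt)); last exact: sqrt_continuous.
  have cn : `|z.2| @[z --> ((x, r) : X * R)] --> `|r|.
    by apply: cvg_norm; exact: cvg_snd.
  have cd : mdist x z.1 @[z --> ((x, r) : X * R)] --> (mdist x x : R).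
    have := @mdist_continuous R X (x, x) => /cvgrPdist_lt md.
    apply/cvgrPdist_lt => e /md; move=> -[[A B] [/= nA nB] AB].
    exists (B, setT) => /=; first by split => //; exact: filterT.
    by move=> [y s] [/= By _]; apply: (AB (x, y)); split => //=; exact: nbhs_singleton.
  apply: cvgD; first by rewrite expr2; apply: cvgM; apply: cvgB => //; exact: cvg_cst.
  apply: cvgM; first by apply: cvgM => //; exact: cvg_cst.
  apply: cvgB; first exact: cvg_cst.
  apply: continuous_cvg; first exact: continuous_cos.
  apply: (@continuous_min _ _ (fun z : X * R => mdist x z.1) (fun=> pi)) => //.
  exact: cvg_cst.
move=> A; rewrite nbhsE => -[U [/open_coneP oU Ux] UA].
have [e e0 eU] := oU _ Ux.
move/cvgrPdist_lt : cg => /(_ e e0); apply: filterS => -[y s].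
rewrite g0 sub0r normrN ger0_norm ?sqrtr_ge0// => gys; apply: UA; apply: eU.
by rewrite cone_dist_class.
Qed.

End cone_maps.

(** * Densities *)

Section density.
Local Open Scope ereal_scope.
Context d (T : measurableType d) (R : realType).
Variables (nu gam : {finite_measure set T -> \bar R}) (s : T -> R).
Hypothesis ms : measurable_fun setT s.
Hypothesis s0 : forall x, (0 <= s x)%R.
Hypothesis gamE : forall A, measurable A -> gam A = \int[nu]_(x in A) (s x)%:E.

(** The function [s] agrees nu-almost everywhere with the Radon-Nikodym derivative, for which the
    change of variables is known. *)
Lemma integral_density (f : T -> \bar R) : measurable_fun setT f ->
  (forall x, 0 <= f x) -> \int[gam]_x f x = \int[nu]_x (f x * (s x)%:E).
Proof.
move=> mf f0.
have gnu : gam `<< nu.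
  apply/null_content_dominatesP => A mA nuA; rewrite gamE//.
  rewrite (eq_integral (fun x => `|(s x)%:E|)); last first.
    by move=> x _; rewrite gee0_abs ?lee_fin.
  by rewrite integral_abs_eq0//; apply/measurable_EFinP; exact: measurable_funTS.
rewrite -(Radon_Nikodym_SigmaFinite.change_of_variables gnu)//.
have mrn : measurable_fun setT (Radon_Nikodym_SigmaFinite.f gam nu).
  exact: measurable_int (Radon_Nikodym_SigmaFinite.f_integrable gnu).
apply: ae_eq_integral => //.
- exact: emeasurable_funM.
- by apply: emeasurable_funM => //; exact/measurable_EFinP.
- apply: ae_eqe_mul2l; apply: integral_ae_eq => //.
  + exact: Radon_Nikodym_SigmaFinite.f_integrable.
  + exact/measurable_EFinP.
  + by move=> A _ mA; rewrite -Radon_Nikodym_SigmaFinite.f_integral// gamE.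
Qed.

(** On {s > 0} the measure nu has density 1/s with respect to gam; its part on {s = 0}, which gam
    does not see, has to be added. This is how the untransported mass enters the conic plan. *)
Lemma integral_density_split (f : T -> \bar R) : measurable_fun setT f ->
  (forall x, 0 <= f x) ->
  \int[gam]_x ((s x)^-1%:E * f x) + \int[nu]_(x in s @^-1` [set 0%R]) f x
    = \int[nu]_x f x.
Proof.
move=> mf f0.
have mN : measurable (s @^-1` [set 0%R]).
  by rewrite -[_ @^-1` _]setTI; exact: ms.
have mV : measurable_fun setT (fun x => (s x)^-1%R).
  rewrite (_ : (fun x => _) = (fun x => s x `^ (-1))%R).
    exact: measurableT_comp (measurable_powR _) ms.
  by apply/funext => x; rewrite powR_inv1.
have mf' : measurable_fun setT (fun x => (s x)^-1%:E * f x).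
  by apply: emeasurable_funM => //; exact/measurable_EFinP.
have f'0 x : 0 <= (s x)^-1%:E * f x by rewrite mule_ge0// lee_fin invr_ge0.
rewrite integral_density//.
rewrite -[in RHS](setvU (s @^-1` [set 0%R])) ge0_integral_setU//; last 3 first.
- exact: measurableC.
- by rewrite setvU.
- by apply/disj_setPS; rewrite setICl.
congr (_ + _); rewrite [RHS]integral_mkcond; apply: eq_integral => x _.
have [sx|sx] := eqVneq (s x) 0%R.
  by rewrite patchE memNset ?sx ?mule0//; apply.
rewrite patchE mem_set; last exact/eqP.
by rewrite muleAC -EFinM mulVf// mul1e.
Qed.

End density.

(** The integral of a nonnegative function is a supremum over the simple functions below it, which
    is monotone for arbitrary functions. Needed for integrands built from [perspective]. *)
Lemma ge0_le_integral_nonmeasurable d (T : measurableType d) (R : realType)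
    (mu : {measure set T -> \bar R}) (f g : T -> \bar R) :
  (forall x, 0 <= f x)%E -> (forall x, f x <= g x)%E ->
  (\int[mu]_x f x <= \int[mu]_x g x)%E.
Proof.
move=> f0 fg; rewrite !ge0_integralTE//; last first.
  by move=> x; exact: le_trans (f0 x) (fg x).
apply: ereal_sup_le => _ [h /= hf <-]; exists h => // x.
exact: le_trans (hf x) (fg x).
Qed.

Lemma ge0_integral_mrestr d (T : measurableType d) (R : realType)
    (mu : {measure set T -> \bar R}) (D : set T) (mD : measurable D)
    (f : T -> \bar R) : measurable_fun setT f -> (forall x, 0 <= f x)%E ->
  (\int[mrestr mu mD]_x f x = \int[mu]_(x in D) f x)%E.
Proof.
move=> mf f0; rewrite (@ge0_negligible_integral _ _ _ _ setT (~` D))//.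
- rewrite setTD setCK; apply: eq_measure_integral => A mA AD.
  by rewrite /= /mrestr setIidl.
- exact: measurableC.
- by rewrite /= /mrestr setICl measure0.
Qed.

Lemma measurable_fun_inv_nonneg d (T : measurableType d) (R : realType)
    (s : T -> R) : measurable_fun setT s -> (forall x, 0 <= s x) ->
  measurable_fun setT (fun x => (s x)^-1).
Proof.
move=> ms s0; rewrite (_ : (fun x => _) = (fun x => s x `^ (-1))).
  exact: measurableT_comp (measurable_powR _) ms.
by apply/funext => x; rewrite powR_inv1.
Qed.

Lemma finite_measure_copy d (T : measurableType d) (R : realType)
    (m : {measure set T -> \bar R}) : (m setT < +oo)%E ->
  exists al : {finite_measure set T -> \bar R}, forall A, al A = m A.
Proof.
move=> my; exists [the {finite_measure set T -> \bar R} of mfrestr measurableT my].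
by move=> A; rewrite /= /mfrestr /mrestr setIT.
Qed.

Section divergence_attained.
Local Open Scope ereal_scope.
Context d (T : measurableType d) (R : realType) (F : R -> \bar R).
Hypothesis F_G0 : Gamma0 F.
Hypothesis F_superlinear : superlinear F.
Hypothesis mF : measurable_fun (@nneg R) F.

(** Two densities of the same finite measure agree nu-almost everywhere, so all admissible
    decompositions give one value. *)
Lemma divergence_attained (g nu : {finite_measure set T -> \bar R}) :
  divergence F g nu < +oo ->
  exists s : T -> R, [/\ measurable_fun setT s, forall x, (0 <= s x)%R,
    forall A, measurable A -> g A = \int[nu]_(x in A) (s x)%:E &
    \int[nu]_x F (s x) = divergence F g nu].
Proof.
have F_ge0 s : (0 <= s)%R -> 0 <= F s by case: F_G0 => + _ _ _; exact.
move=> Dy; have [s [ms s0 gs _]] := divergence_lty F_G0 F_superlinear Dy.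
exists s; split => //; apply/eqP; rewrite eq_le; apply/andP; split; last first.
  apply: ereal_inf_lbound; exists s, mzero; split; last first.
    by rewrite /= /mzero mule0 adde0.
  split => //; first by exists set0 => //; rewrite measure0.
  by move=> A mA; rewrite gs// /= /mzero adde0.
rewrite leNgt; apply/negP => /(divergence_lty F_G0 F_superlinear)[s' [ms' s'0 gs']].
apply/negP; rewrite -leNgt le_eqVlt; apply/orP; left; apply/eqP.
have mE (t : T -> R) : measurable_fun setT t -> measurable_fun setT (EFin \o t).
  by move=> mt; exact/measurable_EFinP.
apply: ae_eq_integral => //.
- exact: measurable_comp_nonneg.
- exact: measurable_comp_nonneg.
- have : ae_eq nu setT (EFin \o s) (EFin \o s').
    apply: integral_ae_eq => //; last 2 first.
    + exact: mE.
    + by move=> A _ mA; rewrite -gs// -gs'.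
    apply/integrableP; split; first exact: mE.
    rewrite (eq_integral (EFin \o s)); last by move=> x _; rewrite gee0_abs ?lee_fin.
    by rewrite -gs// ltey_eq fin_num_measure.
  by apply: filterS => x /= /(_ I)[->].
Qed.

End divergence_attained.

Section marginal_density.
Local Open Scope ereal_scope.
Context d d' (W : measurableType d) (T : measurableType d') (R : realType).
Variables (gam : {finite_measure set W -> \bar R}) (pr : W -> T).
Hypothesis mpr : measurable_fun setT pr.
Variables (nu : {finite_measure set T -> \bar R}) (s : T -> R).
Hypothesis ms : measurable_fun setT s.
Hypothesis s0 : forall x, (0 <= s x)%R.
Hypothesis gamE : forall A, measurable A ->
  pushforward gam pr A = \int[nu]_(x in A) (s x)%:E.

Lemma finite_image_measure : exists g : {finite_measure set T -> \bar R},
  forall A, g A = pushforward gam pr A.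
Proof.
apply: (@finite_measure_copy _ _ _ (image_measure gam mpr)).
by rewrite /= /pushforward preimage_setT ltey_eq fin_num_measure.
Qed.

Lemma integral_marginal_split (f : T -> \bar R) : measurable_fun setT f ->
  (forall x, 0 <= f x) ->
  \int[gam]_w ((s (pr w))^-1%:E * f (pr w))
    + \int[nu]_(x in s @^-1` [set 0%R]) f x = \int[nu]_x f x.
Proof.
move=> mf f0; have [g gE] := finite_image_measure.
have gsE A : measurable A -> g A = \int[nu]_(x in A) (s x)%:E.
  by move=> mA; rewrite gE gamE.
rewrite -(integral_density_split ms s0 gsE mf f0); congr (_ + _).
pose f' x := (s x)^-1%:E * f x.
have mf' : measurable_fun setT f'.
  by apply: emeasurable_funM => //; apply/measurable_EFinP; exact: measurable_fun_inv_nonneg.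
have f'0 x : 0 <= f' x by rewrite mule_ge0// lee_fin invr_ge0.
rewrite (eq_measure_integral (image_measure gam mpr)); last by move=> A _ _; exact: gE.
by rewrite (ge0_integral_pushforward mpr)// => y _; exact: f'0.
Qed.

Lemma marginal_density_null (A : set T) : measurable A -> nu A = 0 ->
  gam.-negligible (pr @^-1` A).
Proof.
move=> mA nuA; apply/negligibleP; first by rewrite -[_ @^-1` _]setTI; exact: mpr.
transitivity (pushforward gam pr A) => //; rewrite gamE//.
rewrite (eq_integral (fun x => `|(s x)%:E|)); last first.
  by move=> x _; rewrite gee0_abs ?lee_fin.
by rewrite integral_abs_eq0//; apply/measurable_EFinP; exact: measurable_funTS.
Qed.

Lemma marginal_density_pos : gam.-negligible (pr @^-1` (s @^-1` [set 0%R])).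
Proof.
have mN : measurable (s @^-1` [set 0%R]) by rewrite -[_ @^-1` _]setTI; exact: ms.
apply/negligibleP; first by rewrite -[_ @^-1` _]setTI; exact: mpr.
transitivity (pushforward gam pr (s @^-1` [set 0%R])) => //; rewrite gamE//.
by rewrite integral0_eq// => x /= ->.
Qed.

End marginal_density.

(** * Inverting the embedding of a support *)

Section isometric_copy.
Context (R : realType).

(** Points of the image converging to y have a Cauchy sequence of preimages; completeness of X gives
    a limit, which lies in the closed set S and is mapped to y. *)
Lemma isometric_closed_image (X Y : polishMetricType R) (S : set X) (f : X -> Y) :
  closed S ->
  (forall x y, S x -> S y -> mdist (f x) (f y) = mdist x y) -> closed (f @` S).
Proof.
move=> cS isof y cy.
have e0 n : 0 < n.+1%:R^-1 :> R by [].
have xP n : exists x, S x /\ mdist y (f x) < n.+1%:R^-1.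
  have [_ [[x Sx <-]]] := cy _ (nbhsx_ballx y _ (e0 n)).
  by rewrite ballEmdist /= => yx; exists x.
have [u uP] := choice xP.
have cu : cauchy (u @ \oo).
  apply: cauchy_exP => e e_gt0; have e20 : 0 < e / 2 by rewrite divr_gt0.
  have [N _ Ne] := near_infty_natSinv_lt (PosNum e20).
  exists (u N); exists N => // n /= Nn; rewrite ballEmdist/=.
  have [SN yN] := uP N; have [Sn yn] := uP n.
  rewrite -(isof _ _ SN Sn) (le_lt_trans (metric_triangle _ y _))// (splitr e).
  rewrite metric_sym; apply: ltrD; [apply: lt_trans yN _|apply: lt_trans yn _].
    exact: (Ne N (leqnn N)).
  exact: (Ne n Nn).
have [x cvu] : exists x : X, u @ \oo --> x.
  by eexists; exact: (cauchy_cvg _ cu).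
have Sx : S x.
  have uS : \forall n \near \oo, S (u n) by apply: nearW => n; exact: (uP n).1.
  have H := @closed_cvg _ _ _ _ u S cS; exact: (H _ _ uS x cvu).
exists x => //; apply: mdist_positivity; apply/eqP; rewrite eq_le mdist_ge0 andbT.
apply/ler_addgt0Pl => e e_gt0; have e20 : 0 < e / 2 by rewrite divr_gt0.
have := metricType_numDomainType.cvgr_dist_lt cvu e20.
move=> [N1 _ N1e]; have [N2 _ N2e] := near_infty_natSinv_lt (PosNum e20).
pose N := maxn N1 N2; have [SN yN] := uP N.
rewrite addr0 (le_trans (metric_triangle _ (f (u N)) _))// (splitr e) lerD//.
  by rewrite isof// ltW// N1e//= leq_maxl.
by rewrite metric_sym (le_trans (ltW yN))// ltW// N2e//= leq_maxr.
Qed.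

Lemma isometric_within_continuous (X Y : polishMetricType R) (S : set X) (f : X -> Y) :
  (forall x y, S x -> S y -> mdist (f x) (f y) = mdist x y) ->
  {within S, continuous f}.
Proof.
move=> isof; apply/subspace_continuousP => x Sx.
apply/metricType_numDomainType.cvgrPdist_lt => e e0.
rewrite near_withinE; have := nbhsx_ballx x _ e0.
by apply: filterS => z; rewrite ballEmdist /= => xz Sz; rewrite isof.
Qed.

(** The embedding lives on the support only, whereas plans live in the common space. The Borel map
    [phi] brings them back to X and carries nu to mu; [Psi] extends the embedding so that costs can
    be written on all of X. *)
Lemma isometric_supp_inverse (X Y : polishMetricType R) (mu : fmeas R X)
    (psi : supp mu -> Y) (nu : fmeas R Y) :
  isometric_embedding psi -> is_supp_pushforward psi nu ->
  exists (Psi : X -> Y) (phi : Y -> X) (S : set Y),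
    [/\ measurable_fun setT (Psi : borel X -> borel Y),
        measurable_fun setT (phi : borel Y -> borel X),
        forall u, S u -> supp mu (phi u) /\ Psi (phi u) = u,
        forall x y, supp mu x -> supp mu y -> mdist (Psi x) (Psi y) = mdist x y &
        [/\ measurable (S : set (borel Y)), nu (~` S) = 0%E &
          forall A, measurable (A : set (borel X)) -> nu (phi @^-1` A) = mu A]].
Proof.
move=> ipsi pnu.
pose Psi (x : X) : Y := if pselect (supp mu x) is left sx
  then psi (SigSub (mem_set sx)) else point.
have PsiE (x : supp mu) : Psi (set_val x) = psi x.
  rewrite /Psi; case: pselect => [sx|]; last by case; exact: set_valP.
  by congr psi; apply: val_inj.
have isoP x y : supp mu x -> supp mu y -> mdist (Psi x) (Psi y) = mdist x y.
  move=> sx sy; have := ipsi (SigSub (mem_set sx)) (SigSub (mem_set sy)).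
  by rewrite -!PsiE.
pose S := Psi @` supp mu.
pose phi (u : Y) : X := get [set x | supp mu x /\ Psi x = u].
have phiP u : S u -> supp mu (phi u) /\ Psi (phi u) = u.
  by move=> [x sx xu]; apply: (@getPex _ [set x | supp mu x /\ Psi x = u]); exists x.
have phiK x : supp mu x -> phi (Psi x) = x.
  move=> sx; have [sp pE] : supp mu (phi (Psi x)) /\ Psi (phi (Psi x)) = Psi x.
    by apply: phiP; exists x.
  by apply: mdist_positivity; rewrite -isoP// pE mdistxx.
have cS : closed S by apply: isometric_closed_image isoP; exact: closed_supp.
have phi_iso u v : S u -> S v -> mdist (phi u) (phi v) = mdist u v.
  move=> /phiP[su uE] /phiP[sv vE].
  by rewrite -isoP// uE vE.
have mPsi : measurable_fun setT (Psi : borel X -> borel Y).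
  apply: (closed_extension_borel (u := point) (@closed_supp _ _ mu)).
    exact: isometric_within_continuous.
  by move=> x; rewrite /Psi; case: pselect.
have mphi : measurable_fun setT (phi : borel Y -> borel X).
  apply: (closed_extension_borel (u := point) cS).
    exact: isometric_within_continuous.
  move=> u Su; rewrite /phi getPN// => x [sx xu]; apply: Su.
  by exists x.
have msupp : measurable (supp mu : set (borel X)).
  by apply: closed_borel; exact: closed_supp.
have nuE A : measurable (A : set (borel Y)) -> nu A = mu (supp mu `&` Psi @^-1` A).
  move=> mA; rewrite pnu//; congr (mu _); apply/seteqP; split => x /=.
    by move=> [y Ay <-]; split; [exact: set_valP|rewrite /= PsiE].
  move=> [sx Ax]; exists (SigSub (mem_set sx)) => //.
  by rewrite /= -PsiE.
exists Psi, phi, S; split => //; split.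
- exact: closed_borel.
- rewrite nuE; last by apply: measurableC; exact: closed_borel.
  rewrite (_ : _ `&` _ = set0) ?measure0//; apply/seteqP; split => x //= -[sx].
  by apply; exists x.
- move=> A mA; rewrite nuE; last by rewrite -[_ @^-1` _]setTI; exact: mphi.
  have -> : supp mu `&` Psi @^-1` (phi @^-1` A) = supp mu `&` A.
    apply/seteqP; split => x /= [sx]; first by rewrite phiK.
    by move=> Ax; rewrite phiK.
  rewrite -[in RHS](setIT A) -(setUv (supp mu)) setIUr measureU//.
  + rewrite [X in _ = _ + X](_ : _ = 0%E) ?adde0; first by rewrite setIC.
    apply: (subset_measure0 _ _ _ (measure_supp mu)) => //.
      by apply: measurableI => //; exact: measurableC.
    exact: measurableC.
  + exact: measurableI.
  + by apply: measurableI => //; exact: measurableC.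
  + by rewrite setIACA setICr setI0.
Qed.

End isometric_copy.

(** * The conic energy *)

Section plan_cost.
Local Open Scope ereal_scope.
Context (R : realType) (a p : R) (F l : R -> \bar R).
Hypothesis hET : regular_ET a F l.
Hypothesis hp : (1 <= p)%R.
Context (X1 X2 X : polishMetricType R) (x1 : X1) (x2 : X2).
Variables (Psi1 : X1 -> X) (Psi2 : X2 -> X) (S1 : set X1) (S2 : set X2).
Hypothesis iso1 : forall x y, S1 x -> S1 y -> mdist (Psi1 x) (Psi1 y) = mdist x y.
Hypothesis iso2 : forall x y, S2 x -> S2 y -> mdist (Psi2 x) (Psi2 y) = mdist x y.
Hypothesis mPsi1 : measurable_fun setT (Psi1 : borel X1 -> borel X).
Hypothesis mPsi2 : measurable_fun setT (Psi2 : borel X2 -> borel X).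
Hypothesis mS1 : measurable (S1 : set (borel X1)).
Hypothesis mS2 : measurable (S2 : set (borel X2)).

Local Notation cone2 := (cone X1 * cone X2)%type.

Let pos1 := (@pos1 R X1 X2 x1).
Let pos2 := (@pos2 R X1 X2 x2).
Let r1 := (@r1 R X1 X2).
Let r2 := (@r2 R X1 X2).

Let r1_ge0 z : (0 <= r1 z)%R. Proof. exact: cone_r_ge0. Qed.
Let r2_ge0 z : (0 <= r2 z)%R. Proof. exact: cone_r_ge0. Qed.

Definition both_massive : set cone2 := [set z | (0 < r1 z)%R /\ (0 < r2 z)%R].
Definition both_in_image : set cone2 := [set z | S1 (pos1 z) /\ S2 (pos2 z)].

(* The cost is infinite off the images of the supports, so that the pointwise
   bound below holds everywhere and not only almost everywhere. A point with one
   component at the vertex (theta = 0) costs F 0 per unit of mass, whatever the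
   positions. *)
Definition plan_cost (z : cone2) : \bar R :=
  one_point_cost F (\1_both_massive z) (r1 z `^ p)%R (r2 z `^ p)%R
    (l (mdist (Psi1 (pos1 z)) (Psi2 (pos2 z)))
      + +oo * (\1_(~` both_in_image) z)%:E).

Let th_ge0 z : (0 <= \1_both_massive z :> R)%R. Proof. by rewrite indicE. Qed.

Let l_ge0 s : (0 <= s)%R -> 0 <= l s.
Proof. by case: hET => _ _ [+ _ _ _] _; exact. Qed.

Let F_G0 : Gamma0 F. Proof. by case: hET => _ []. Qed.

Let extra_ge0 z : 0 <= +oo * (\1_(~` both_in_image) z)%:E :> \bar R.
Proof. by rewrite mule_ge0// lee_fin indicE. Qed.

Lemma plan_cost_ge0 z : 0 <= plan_cost z.
Proof.
rewrite one_point_cost_ge0 ?powR_ge0// adde_ge0// l_ge0//.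
exact: mdist_ge0.
Qed.

Lemma perspective_le_plan_cost z z' :
  perspective F (l `|mdist (pos1 z) (pos1 z') - mdist (pos2 z) (pos2 z')|%R)
      (((r1 z * r1 z') `^ p)%R, ((r2 z * r2 z') `^ p)%R) `^ a
  <= ((r1 z' `^ p)%:E * plan_cost z) `^ a
   + ((r2 z `^ p)%:E * plan_cost z') `^ a.
Proof.
set delta := `|_|%R.
have p0 : (0 < p)%R by exact: lt_le_trans hp.
pose good z := both_massive z /\ both_in_image z.
(* Off the good points the value delta makes delta <= D z + D z' hold trivially. It is harmless
   there: either theta = 0 and the distance is multiplied by 0, or [plan_cost] is infinite. *)
pose D z := if pselect (good z) is left _
  then mdist (Psi1 (pos1 z)) (Psi2 (pos2 z)) else delta.
have d0 : (0 <= delta)%R by exact: normr_ge0.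
have D0 w : (0 <= D w)%R by rewrite /D; case: pselect => // _; exact: mdist_ge0.
have thP w : (0 < \1_both_massive w :> R)%R -> (0 < r1 w `^ p)%R /\ (0 < r2 w `^ p)%R.
  rewrite indicE; case: (boolP (w \in both_massive)) => [|_]; last by rewrite ltxx.
  by rewrite inE => -[rw sw] _; split; exact: powR_gt0.
have cD w : one_point_cost F (\1_both_massive w) (r1 w `^ p)%R (r2 w `^ p)%R (l (D w))
    <= plan_cost w.
  rewrite /plan_cost /D; case: pselect => [gw|ngw].
    by apply: le_one_point_cost; rewrite ?leeDl.
  rewrite indicE; case: (boolP (w \in both_massive)) => /= mw; last first.
    by rewrite /one_point_cost !mul0e.
  apply: le_one_point_cost => //.
  have -> : \1_(~` both_in_image) w = 1%R :> R.
    rewrite indicE mem_set// => bw; apply: ngw; split => //.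
    by move: mw; rewrite inE.
  rewrite mule1 addey ?leey//.
  by rewrite gt_eqF// (@lt_le_trans _ _ 0)// l_ge0// mdist_ge0.
have dD : (delta <= D z + D z')%R.
  rewrite /D; case: pselect => [[_ [/= gx gy]]|_]; last first.
    by rewrite lerDl; exact: D0.
  case: pselect => [[_ [/= gx' gy']]|_]; last first.
    by rewrite lerDr; exact: mdist_ge0.
  rewrite /delta -(iso1 gx gx') -(iso2 gy gy').
  exact: mdist_lipschitz.
rewrite !powRM//.
exact: (perspective_product_le hET (powR_ge0 _ _) (powR_ge0 _ _) (powR_ge0 _ _) (powR_ge0 _ _)
  (th_ge0 z) (thP z) (th_ge0 z') (thP z') (D0 z) (D0 z') d0 dD (cD z) (cD z')).
Qed.

Let mfst : measurable_fun setT (fst : borel cone2 -> borel (cone X1)).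
Proof. by apply: continuous_borel => z; exact: cvg_fst. Qed.

Let msnd : measurable_fun setT (snd : borel cone2 -> borel (cone X2)).
Proof. by apply: continuous_borel => z; exact: cvg_snd. Qed.

Lemma measurable_r1 : measurable_fun setT (r1 : borel cone2 -> R).
Proof. exact: measurableT_comp (@measurable_cone_r R X1) mfst. Qed.

Lemma measurable_r2 : measurable_fun setT (r2 : borel cone2 -> R).
Proof. exact: measurableT_comp (@measurable_cone_r R X2) msnd. Qed.

Lemma measurable_pos1 : measurable_fun setT (pos1 : borel cone2 -> borel X1).
Proof. exact: measurableT_comp (@measurable_cone_x R X1 x1) mfst. Qed.

Lemma measurable_pos2 : measurable_fun setT (pos2 : borel cone2 -> borel X2).
Proof. exact: measurableT_comp (@measurable_cone_x R X2 x2) msnd. Qed.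

Lemma measurable_mass1 : measurable_fun setT ((fun z => (r1 z `^ p)%R) : borel cone2 -> R).
Proof. exact: measurableT_comp (measurable_powR _) measurable_r1. Qed.

Lemma measurable_mass2 : measurable_fun setT ((fun z => (r2 z `^ p)%R) : borel cone2 -> R).
Proof. exact: measurableT_comp (measurable_powR _) measurable_r2. Qed.

Lemma measurable_plan_cost :
  measurable_fun setT (plan_cost : borel cone2 -> \bar R).
Proof.
have mM : measurable (both_massive : set (borel cone2)).
  rewrite (_ : both_massive = r1 @^-1` `]0%R, +oo[ `&` r2 @^-1` `]0%R, +oo[).
    apply: measurableI; rewrite -[_ @^-1` _]setTI.
      exact: measurable_r1.
    exact: measurable_r2.
  by apply/seteqP; split => z /=; rewrite !in_itv/= !andbT.
have mI : measurable (both_in_image : set (borel cone2)).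
  rewrite (_ : both_in_image = pos1 @^-1` S1 `&` pos2 @^-1` S2)//.
  have := measurable_pos1 measurableT mS1; have := measurable_pos2 measurableT mS2.
  by rewrite !setTI => m2 m1; exact: measurableI.
have mth : measurable_fun setT ((\1_both_massive : cone2 -> R) : borel cone2 -> R).
  exact: measurable_indic.
have mF (m : borel cone2 -> R) : measurable_fun setT m -> (forall z, 0 <= m z)%R ->
    measurable_fun setT
      ((fun z => (m z)%:E * F (\1_both_massive z / m z)%R) : borel cone2 -> \bar R).
  move=> mm m0; apply: emeasurable_funM; first exact/measurable_EFinP.
  apply: measurable_comp_nonneg; first exact: measurable_regular_ET_entropy hET.
    by apply: measurable_funM => //; exact: measurable_fun_inv_nonneg.
  by move=> z; rewrite divr_ge0.
apply: emeasurable_funD; first apply: emeasurable_funD.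
- by apply: mF => [|z]; [exact: measurable_mass1|exact: powR_ge0].
- by apply: mF => [|z]; [exact: measurable_mass2|exact: powR_ge0].
apply: emeasurable_funM; first exact/measurable_EFinP.
apply: emeasurable_funD.
  have mpair : measurable_fun setT
     ((fun z => (Psi1 (pos1 z), Psi2 (pos2 z))) : borel cone2 -> borel (X * X)%type).
    apply: measurable_pair_borel.
    - exact: polish_countable_base.
    - exact: polish_countable_base.
    - exact: measurableT_comp mPsi1 measurable_pos1.
    - exact: measurableT_comp mPsi2 measurable_pos2.
  exact: measurableT_comp (@measurable_regular_ET_cost _ _ _ _ hET X) mpair.
apply: measurable_funeM; apply/measurable_EFinP; apply: measurable_indic.
exact: measurableC.
Qed.

(* The bound on the integrand separates z from z' up to the weights L1, L2, so
   that the iterated integral needs neither measurability nor Fubini. *)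
Lemma conic_energy_le (al : fmeas R cone2) (M1 M2 : R) :
  (0 <= M1)%R -> (0 <= M2)%R ->
  \int[al]_z (r1 z `^ p)%:E = M1%:E -> \int[al]_z (r2 z `^ p)%:E = M2%:E ->
  conic_energy F l p x1 x2 al
    <= ((M1 `^ a + M2 `^ a) `^ a^-1)%:E * \int[al]_z plan_cost z.
Proof.
move=> M10 M20 E1 E2.
have [a01 [FG0 Fsup Ffin] _ _] := hET.
have [L1 [L2 [L10 L20 LM LP]]] := poweR_add_le_weights a01 M10 M20.
set H := \int[al]_z plan_cost z.
have H0 : 0 <= H by apply: integral_ge0 => z _; exact: plan_cost_ge0.
have mh := measurable_plan_cost.
have m1 : measurable_fun setT ((fun z => (r1 z `^ p)%:E) : borel cone2 -> \bar R).
  by apply/measurable_EFinP; exact: measurable_mass1.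
have m2 : measurable_fun setT ((fun z => (r2 z `^ p)%:E) : borel cone2 -> \bar R).
  by apply/measurable_EFinP; exact: measurable_mass2.
pose P z z' := perspective F
  (l `|mdist (pos1 z) (pos1 z') - mdist (pos2 z) (pos2 z')|%R)
  (((r1 z * r1 z') `^ p)%R, ((r2 z * r2 z') `^ p)%R).
have P0 z z' : 0 <= P z z'.
  by apply: perspective_ge0 => //; rewrite ?powR_ge0 ?l_ge0.
have PB z z' : P z z' <= L1 * plan_cost z * (r1 z' `^ p)%:E + L2 * (r2 z `^ p)%:E * plan_cost z'.
  rewrite -!muleA [plan_cost z * _]muleC; apply: LP => //.
  - by rewrite mule_ge0 ?plan_cost_ge0// lee_fin powR_ge0.
  - by rewrite mule_ge0 ?plan_cost_ge0// lee_fin powR_ge0.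
  - exact: perspective_le_plan_cost.
have inner z : \int[al]_z' P z z' <= L1 * M1%:E * plan_cost z + L2 * H * (r2 z `^ p)%:E.
  apply: (@le_trans _ _ (\int[al]_z' (L1 * plan_cost z * (r1 z' `^ p)%:E
      + L2 * (r2 z `^ p)%:E * plan_cost z'))).
    exact: ge0_le_integral_nonmeasurable.
  have c1 : 0 <= L1 * plan_cost z by rewrite mule_ge0 ?plan_cost_ge0.
  have c2 : 0 <= L2 * (r2 z `^ p)%:E by rewrite mule_ge0// lee_fin powR_ge0.
  rewrite ge0_integralD//; last 4 first.
  - by move=> z' _; rewrite mule_ge0// lee_fin powR_ge0.
  - exact: measurable_funeM.
  - by move=> z' _; rewrite mule_ge0// plan_cost_ge0.
  - exact: measurable_funeM.
  rewrite !ge0_integralZl//; last 2 first.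
  - by move=> z' _; exact: plan_cost_ge0.
  - by move=> z' _; rewrite lee_fin powR_ge0.
  by rewrite E1 -/H muleAC [L2 * _ * H]muleAC.
apply: (@le_trans _ _ (\int[al]_z (L1 * M1%:E * plan_cost z + L2 * H * (r2 z `^ p)%:E))).
  apply: ge0_le_integral_nonmeasurable => // z.
  by apply: integral_ge0 => z' _; exact: P0.
have c1 : 0 <= L1 * M1%:E by rewrite mule_ge0.
have c2 : 0 <= L2 * H by rewrite mule_ge0.
rewrite ge0_integralD//; last 4 first.
- by move=> z _; rewrite mule_ge0// plan_cost_ge0.
- exact: measurable_funeM.
- by move=> z _; rewrite mule_ge0// lee_fin powR_ge0.
- exact: measurable_funeM.
rewrite !ge0_integralZl//; last 2 first.
- by move=> z _; rewrite lee_fin powR_ge0.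
- by move=> z _; exact: plan_cost_ge0.
(* Both terms carry the same [H], so the coefficients add up to L1 M1 + L2 M2, the sum for which the
   weights were chosen. *)
rewrite E2 -/H [L2 * H * _]muleAC -ge0_muleDl ?mule_ge0//.
exact: lee_wpmul2r.
Qed.

End plan_cost.

(** * The conic plan of a transport plan *)

(** Pairs are formed in (X1 * R) * (X2 * R), whose factors have countable bases, and then mapped
    continuously to the product of the cones; no countable base of a cone is involved. *)
Lemma measurable_cone_pair (R : realType) (X1 X2 : polishMetricType R) d
    (W : measurableType d) (f : W -> X1) (q : W -> R) (g : W -> X2) (q' : W -> R) :
  measurable_fun setT (f : W -> borel X1) -> measurable_fun setT q ->
  measurable_fun setT (g : W -> borel X2) -> measurable_fun setT q' ->
  measurable_fun setT
    ((fun w => (cone_point (f w, q w), cone_point (g w, q' w)))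
       : W -> borel (cone X1 * cone X2)%type).
Proof.
move=> mf mq mg mq'.
have mR (k : W -> R) : measurable_fun setT k -> measurable_fun setT (k : W -> borel R).
  by move=> /measurable_realP mk; apply/measurable_fun_borelP.
have mpair : measurable_fun setT ((fun w => ((f w, q w), (g w, q' w)))
    : W -> borel ((X1 * R) * (X2 * R))%type).
  have b1 := polish_countable_base X1; have b2 := polish_countable_base X2.
  have bR := @real_countable_base R.
  apply: measurable_pair_borel;
    [exact: prod_countable_base b1 bR|exact: prod_countable_base b2 bR| |].
    by apply: measurable_pair_borel => //; exact: mR.
  by apply: measurable_pair_borel => //; exact: mR.
pose K (z : (X1 * R) * (X2 * R)) : cone X1 * cone X2 := (cone_point z.1, cone_point z.2).
have mK : measurable_fun setT
    (K : borel ((X1 * R) * (X2 * R))%type -> borel (cone X1 * cone X2)%type).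
  apply: continuous_borel => z.
  have c1 : {for z, continuous (@cone_point R X1 \o fst)}.
    by apply: continuous_comp; [exact: cvg_fst|exact: cone_point_continuous].
  have c2 : {for z, continuous (@cone_point R X2 \o snd)}.
    by apply: continuous_comp; [exact: cvg_snd|exact: cone_point_continuous].
  exact: cvg_pair c1 c2.
exact: measurableT_comp mK mpair.
Qed.

(** The absolute value comes from [cone_point]. At s = 0 both sides take the default value 0. *)
Lemma powR_root_inv (R : realType) (p s : R) : 1 <= p -> 0 <= s ->
  `|s `^ (- p^-1)| `^ p = s^-1.
Proof.
move=> p1 s0; have p0 : p != 0 by rewrite gt_eqF// (lt_le_trans _ p1).
rewrite ger0_norm ?powR_ge0// -powRrM mulNr mulVf// powR_inv1//.
Qed.

Section conic_plan.
Local Open Scope ereal_scope.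
Context (R : realType) (a p : R) (F l : R -> \bar R).
Hypothesis hET : regular_ET a F l.
Hypothesis hp : (1 <= p)%R.
Context (X1 X2 X : polishMetricType R) (x1 : X1) (x2 : X2).
Variables (mu1 : fmeas R X1) (mu2 : fmeas R X2) (nu1 nu2 : fmeas R X).
Variables (Psi1 : X1 -> X) (Psi2 : X2 -> X) (phi1 : X -> X1) (phi2 : X -> X2).
Variables (S1 : set X1) (S2 : set X2) (T1 T2 : set X).
Hypothesis mPsi1 : measurable_fun setT (Psi1 : borel X1 -> borel X).
Hypothesis mPsi2 : measurable_fun setT (Psi2 : borel X2 -> borel X).
Hypothesis mphi1 : measurable_fun setT (phi1 : borel X -> borel X1).
Hypothesis mphi2 : measurable_fun setT (phi2 : borel X -> borel X2).
Hypothesis mS1 : measurable (S1 : set (borel X1)).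
Hypothesis mS2 : measurable (S2 : set (borel X2)).
Hypothesis mT1 : measurable (T1 : set (borel X)).
Hypothesis mT2 : measurable (T2 : set (borel X)).
Hypothesis phi1P : forall u, T1 u -> S1 (phi1 u) /\ Psi1 (phi1 u) = u.
Hypothesis phi2P : forall u, T2 u -> S2 (phi2 u) /\ Psi2 (phi2 u) = u.
Hypothesis nuT1 : nu1 (~` T1) = 0.
Hypothesis nuT2 : nu2 (~` T2) = 0.
Hypothesis nuphi1 : forall A, measurable (A : set (borel X1)) -> nu1 (phi1 @^-1` A) = mu1 A.
Hypothesis nuphi2 : forall A, measurable (A : set (borel X2)) -> nu2 (phi2 @^-1` A) = mu2 A.
Variables (gam : fmeas R (X * X)%type) (s1 s2 : X -> R).
Hypothesis ms1 : measurable_fun setT (s1 : borel X -> R).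
Hypothesis ms2 : measurable_fun setT (s2 : borel X -> R).
Hypothesis s1_ge0 : forall u, (0 <= s1 u)%R.
Hypothesis s2_ge0 : forall u, (0 <= s2 u)%R.
Hypothesis gam1 : forall A, measurable A ->
  pushforward gam (fst : borel (X * X)%type -> borel X) A
    = \int[nu1]_(x in A) (s1 x)%:E.
Hypothesis gam2 : forall A, measurable A ->
  pushforward gam (snd : borel (X * X)%type -> borel X) A
    = \int[nu2]_(x in A) (s2 x)%:E.

Local Notation cone2 := (cone X1 * cone X2)%type.
Local Notation XX := (borel (X * X)%type).
Local Notation N1 := (s1 @^-1` [set 0%R] : set (borel X)).
Local Notation N2 := (s2 @^-1` [set 0%R] : set (borel X)).

Let mfst : measurable_fun setT (fst : XX -> borel X).
Proof. by apply: continuous_borel => z; exact: cvg_fst. Qed.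

Let msnd : measurable_fun setT (snd : XX -> borel X).
Proof. by apply: continuous_borel => z; exact: cvg_snd. Qed.

(* For s = 0 the radius 0 `^ (- p^-1) is the junk value 0, on a gam-null set. *)
Let G1 (w : XX) : borel cone2 :=
  (cone_point (phi1 w.1, s1 w.1 `^ (- p^-1))%R, cone_point (phi2 w.2, s2 w.2 `^ (- p^-1))%R).
Let G2 (u : borel X) : borel cone2 :=
  (cone_point (phi1 u, 1%R), cone_point (x2, 0%R)).
Let G3 (v : borel X) : borel cone2 :=
  (cone_point (x1, 0%R), cone_point (phi2 v, 1%R)).

Let mG1 : measurable_fun setT G1.
Proof.
apply: measurable_cone_pair.
- exact: measurableT_comp mphi1 mfst.
- exact: measurableT_comp (measurable_powR _) (measurableT_comp ms1 mfst).
- exact: measurableT_comp mphi2 msnd.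
- exact: measurableT_comp (measurable_powR _) (measurableT_comp ms2 msnd).
Qed.

Let mG2 : measurable_fun setT G2.
Proof. by apply: measurable_cone_pair. Qed.

Let mG3 : measurable_fun setT G3.
Proof. by apply: measurable_cone_pair. Qed.

Let mN1 : measurable N1. Proof. by rewrite -[_ @^-1` _]setTI; exact: ms1. Qed.
Let mN2 : measurable N2. Proof. by rewrite -[_ @^-1` _]setTI; exact: ms2. Qed.

(** Described through integrals because both the homogeneous marginals and the plan cost are
    integrals against [al]. *)
Lemma conic_plan_measure : exists al : fmeas R cone2, forall f : cone2 -> \bar R,
  measurable_fun setT (f : borel cone2 -> \bar R) -> (forall z, 0 <= f z) ->
  \int[al]_z f z = \int[gam]_w f (G1 w)
    + (\int[nu1]_(u in N1) f (G2 u) + \int[nu2]_(v in N2) f (G3 v)).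
Proof.
pose m23 := [the {measure set (borel cone2) -> \bar R} of
  measure_add (image_measure (mrestr nu1 mN1) mG2) (image_measure (mrestr nu2 mN2) mG3)].
pose m := [the {measure set (borel cone2) -> \bar R} of
  measure_add (image_measure gam mG1) m23].
have [|al alE] := @finite_measure_copy _ _ _ m.
  have mE : m setT = gam setT + (mrestr nu1 mN1 setT + mrestr nu2 mN2 setT).
    exact: etrans (measure_addE _ m23 _) (congr1 _ (measure_addE _ _ _)).
  by rewrite mE !lte_add_pinfty// ltey_eq fin_num_measure.
exists al => f mf f0.
have pushE d (W : measurableType d) (g : {measure set W -> \bar R}) (G : W -> borel cone2)
    (mG : measurable_fun setT G) : \int[image_measure g mG]_z f z = \int[g]_w f (G w).
  by rewrite (ge0_integral_pushforward mG)// => z _; exact: f0.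
rewrite (eq_measure_integral m); last by move=> A _ _; exact: alE.
rewrite ge0_integral_measure_add// ge0_integral_measure_add// !pushE.
rewrite !ge0_integral_mrestr//.
- exact: measurableT_comp mf mG3.
- exact: measurableT_comp mf mG2.
Qed.

Let p0 : p != 0%R. Proof. by rewrite gt_eqF// (lt_le_trans _ hp). Qed.

Let cone_rE (Y : polishMetricType R) (y : Y) (q : R) : cone_r (cone_point (y, q)) = `|q|%R.
Proof. by rewrite /cone_point cone_r_class. Qed.

Let cone_xE (Y : polishMetricType R) (y0 y : Y) (q : R) : q != 0%R ->
  cone_x y0 (cone_point (y, q)) = y.
Proof. by move=> q0; rewrite /cone_point cone_x_class/= normr_gt0 q0. Qed.

Let root_neq0 (s : R) : (0 <= s)%R -> s != 0%R -> (s `^ (- p^-1) != 0)%R.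
Proof. by move=> s0 sN; rewrite gt_eqF// powR_gt0// lt_def sN. Qed.

Let hmarginalE (Y : polishMetricType R) (r : cone2 -> R) (pos : cone2 -> Y)
    (al : fmeas R cone2) (A : set (borel Y)) :
  hmarginal p r pos al A = \int[al]_z (((r z `^ p)%:E) * (\1_A (pos z))%:E).
Proof.
rewrite /hmarginal integral_mkcond; apply: eq_integral => z _.
rewrite patchE indicE /= (_ : (z \in pos @^-1` A) = (pos z \in A))//.
by case: ifPn => _; rewrite ?mule1 ?mule0.
Qed.

(** On [G1] the factor r^p = 1/s1 undoes the density and restores nu1 on {s1 > 0}; [G2] has radius 1
    and supplies nu1 on {s1 = 0}; [G3] has its first component at the vertex and contributes
    nothing. *)
Lemma conic_plan_marginal1 (al : fmeas R cone2) (A : set (borel X1)) :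
  (forall f : cone2 -> \bar R,
    measurable_fun setT (f : borel cone2 -> \bar R) -> (forall z, 0 <= f z) ->
    \int[al]_z f z = \int[gam]_w f (G1 w)
      + (\int[nu1]_(u in N1) f (G2 u) + \int[nu2]_(v in N2) f (G3 v))) ->
  measurable A -> hmarginal p (@r1 R X1 X2) (@pos1 R X1 X2 x1) al A = mu1 A.
Proof.
move=> alE mA; rewrite hmarginalE alE; last 2 first.
- apply: emeasurable_funM; apply/measurable_EFinP; first exact: (measurable_mass1 p).
  have mi : measurable_fun setT ((\1_A : X1 -> R) : borel X1 -> R) by exact: measurable_indic.
  exact: measurableT_comp mi (measurable_pos1 x1).
- by move=> z; rewrite mule_ge0 ?lee_fin ?powR_ge0// indicE.
have mB : measurable (phi1 @^-1` A : set (borel X)).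
  by rewrite -[_ @^-1` _]setTI; exact: mphi1.
have mf : measurable_fun setT ((fun u => (\1_(phi1 @^-1` A) u)%:E) : borel X -> \bar R).
  by apply/measurable_EFinP; exact: measurable_indic.
have f0 u : 0 <= (\1_(phi1 @^-1` A) u : R)%:E by rewrite lee_fin indicE.
rewrite [X in _ + (_ + X)]integral0_eq ?adde0; last first.
  by move=> v _; rewrite /G3 /r1 /= cone_rE normr0 powR0// mul0e.
rewrite -nuphi1// -[phi1 @^-1` A]setIT -integral_indic//.
rewrite -(integral_marginal_split mfst ms1 s1_ge0 gam1 mf f0); congr (_ + _).
- apply: eq_integral => w _; rewrite /G1 /r1 /pos1 /= cone_rE powR_root_inv//.
  have [->|sN] := eqVneq (s1 w.1) 0%R; first by rewrite invr0 !mul0e.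
  by rewrite cone_xE// root_neq0.
- apply: eq_integral => u _; rewrite /G2 /r1 /pos1 /= cone_rE normr1 powR1 mul1e.
  by rewrite cone_xE// oner_neq0.
Qed.

Lemma conic_plan_marginal2 (al : fmeas R cone2) (A : set (borel X2)) :
  (forall f : cone2 -> \bar R,
    measurable_fun setT (f : borel cone2 -> \bar R) -> (forall z, 0 <= f z) ->
    \int[al]_z f z = \int[gam]_w f (G1 w)
      + (\int[nu1]_(u in N1) f (G2 u) + \int[nu2]_(v in N2) f (G3 v))) ->
  measurable A -> hmarginal p (@r2 R X1 X2) (@pos2 R X1 X2 x2) al A = mu2 A.
Proof.
move=> alE mA; rewrite hmarginalE alE; last 2 first.
- apply: emeasurable_funM; apply/measurable_EFinP; first exact: (measurable_mass2 p).
  have mi : measurable_fun setT ((\1_A : X2 -> R) : borel X2 -> R) by exact: measurable_indic.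
  exact: measurableT_comp mi (measurable_pos2 x2).
- by move=> z; rewrite mule_ge0 ?lee_fin ?powR_ge0// indicE.
have mB : measurable (phi2 @^-1` A : set (borel X)).
  by rewrite -[_ @^-1` _]setTI; exact: mphi2.
have mf : measurable_fun setT ((fun u => (\1_(phi2 @^-1` A) u)%:E) : borel X -> \bar R).
  by apply/measurable_EFinP; exact: measurable_indic.
have f0 u : 0 <= (\1_(phi2 @^-1` A) u : R)%:E by rewrite lee_fin indicE.
rewrite [X in _ + (X + _)]integral0_eq ?add0e; last first.
  by move=> v _; rewrite /G2 /r2 /= cone_rE normr0 powR0// mul0e.
rewrite -nuphi2// -[phi2 @^-1` A]setIT -integral_indic//.
rewrite -(integral_marginal_split msnd ms2 s2_ge0 gam2 mf f0); congr (_ + _).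
- apply: eq_integral => w _; rewrite /G1 /r2 /pos2 /= cone_rE powR_root_inv//.
  have [->|sN] := eqVneq (s2 w.2) 0%R; first by rewrite invr0 !mul0e.
  by rewrite cone_xE// root_neq0.
- apply: eq_integral => u _; rewrite /G3 /r2 /pos2 /= cone_rE normr1 powR1 mul1e.
  by rewrite cone_xE// oner_neq0.
Qed.

Local Notation h := (plan_cost p F l x1 x2 Psi1 Psi2 S1 S2).

Lemma plan_cost_singular1 u : h (G2 u) = F 0%R.
Proof.
have bm : \1_(@both_massive R X1 X2) (G2 u) = 0%R :> R.
  rewrite indicE memNset// => -[_].
  by rewrite /G2 /r2 /= cone_rE normr0 ltxx.
rewrite /plan_cost /one_point_cost bm !mul0r mul0e adde0.
by rewrite /G2 /r1 /r2 /= !cone_rE normr0 normr1 powR1 powR0// mul1e mul0e adde0.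
Qed.

Lemma plan_cost_singular2 v : h (G3 v) = F 0%R.
Proof.
have bm : \1_(@both_massive R X1 X2) (G3 v) = 0%R :> R.
  rewrite indicE memNset// => -[].
  by rewrite /G3 /r1 /= cone_rE normr0 ltxx.
rewrite /plan_cost /one_point_cost bm !mul0r mul0e adde0.
by rewrite /G3 /r1 /r2 /= !cone_rE normr0 normr1 powR1 powR0// mul1e mul0e add0e.
Qed.

(** The masses are 1/s1 and 1/s2 with theta = 1, so [F] is evaluated at the inverse masses, that is
    at the densities; the infinite penalty vanishes because [phi1] and [phi2] land in [S1] and
    [S2]. *)
Lemma plan_cost_regular w : s1 w.1 != 0%R -> s2 w.2 != 0%R -> T1 w.1 -> T2 w.2 ->
  h (G1 w) = (s1 w.1)^-1%:E * F (s1 w.1) + (s2 w.2)^-1%:E * F (s2 w.2)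
    + l (mdist w.1 w.2).
Proof.
move=> s1N s2N /phi1P[S1w P1w] /phi2P[S2w P2w].
have bm : \1_(@both_massive R X1 X2) (G1 w) = 1%R :> R.
  rewrite indicE mem_set//; split; rewrite /G1 /r1 /r2 /= cone_rE normr_gt0 root_neq0//.
have pos1E : Defs.pos1 x1 (G1 w) = phi1 w.1 by rewrite /pos1 /= cone_xE// root_neq0.
have pos2E : Defs.pos2 x2 (G1 w) = phi2 w.2 by rewrite /pos2 /= cone_xE// root_neq0.
have bi : \1_(~` both_in_image x1 x2 S1 S2) (G1 w) = 0%R :> R.
  by rewrite indicE memNset//; apply; rewrite /both_in_image /= pos1E pos2E.
rewrite /plan_cost bm bi pos1E pos2E P1w P2w mule0 adde0 /one_point_cost mul1e.
by rewrite /G1 /r1 /r2 /= !cone_rE !powR_root_inv// !div1r !invrK.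
Qed.

Lemma conic_plan_exists : exists2 al : fmeas R cone2, conic_plans p x1 x2 mu1 mu2 al &
  \int[al]_z h z <=
    \int[nu1]_u F (s1 u) + \int[nu2]_u F (s2 u) + \int[gam]_w l (mdist w.1 w.2).
Proof.
have [al alE] := conic_plan_measure.
exists al.
  by split => A mA; [exact: conic_plan_marginal1|exact: conic_plan_marginal2].
have [_ [FG0 _ _] [l_ge0 _ _ _] _] := hET.
have F_ge0 s : (0 <= s)%R -> 0 <= F s by case: FG0 => + _ _ _; exact.
have mh := measurable_plan_cost p hET x1 x2 mPsi1 mPsi2 mS1 mS2.
have h0 z : 0 <= h z := plan_cost_ge0 p hET x1 x2 Psi1 Psi2 S1 S2 z.
have mF := measurable_regular_ET_entropy hET.
have ml := @measurable_regular_ET_cost _ _ _ _ hET X.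
have mF1 : measurable_fun setT ((fun u => F (s1 u)) : borel X -> \bar R).
  exact: measurable_comp_nonneg.
have mF2 : measurable_fun setT ((fun u => F (s2 u)) : borel X -> \bar R).
  exact: measurable_comp_nonneg.
rewrite alE//.
rewrite -(integral_marginal_split mfst ms1 s1_ge0 gam1 mF1); last by move=> u; exact: F_ge0.
rewrite -(integral_marginal_split msnd ms2 s2_ge0 gam2 mF2); last by move=> u; exact: F_ge0.
(* On {s1 = 0} the singular cost [F 0] is [F (s1 u)], which is the residual term of the split of the
   divergence integral; likewise for s2. *)
rewrite [X in _ + (X + _)](eq_integral ((fun u => F (s1 u)) : borel X -> \bar R)); last first.
  by move=> u; rewrite inE /= => ->; exact: plan_cost_singular1.
rewrite [X in _ + (_ + X)](eq_integral ((fun u => F (s2 u)) : borel X -> \bar R)); last first.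
  by move=> u; rewrite inE /= => ->; exact: plan_cost_singular2.
set J1 := \int[nu1]_(_ in _) _; set J2 := \int[nu2]_(_ in _) _.
pose f1 (w : XX) := (s1 w.1)^-1%:E * F (s1 w.1).
pose f2 (w : XX) := (s2 w.2)^-1%:E * F (s2 w.2).
pose f3 (w : XX) := l (mdist w.1 w.2).
have mf1 : measurable_fun setT f1.
  apply: emeasurable_funM; last exact: measurableT_comp mF1 mfst.
  by apply/measurable_EFinP; apply: measurable_fun_inv_nonneg => //;
    exact: measurableT_comp ms1 mfst.
have mf2 : measurable_fun setT f2.
  apply: emeasurable_funM; last exact: measurableT_comp mF2 msnd.
  by apply/measurable_EFinP; apply: measurable_fun_inv_nonneg => //;
    exact: measurableT_comp ms2 msnd.
have f10 w : 0 <= f1 w by rewrite mule_ge0 ?lee_fin ?invr_ge0// F_ge0.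
have f20 w : 0 <= f2 w by rewrite mule_ge0 ?lee_fin ?invr_ge0// F_ge0.
have f30 w : 0 <= f3 w by rewrite l_ge0// mdist_ge0.
(* The two integrands agree off four gam-null sets: zeros of either density, and points with a
   coordinate outside [T1] or [T2]. *)
have -> : \int[gam]_w h (G1 w) = \int[gam]_w (f1 w + f2 w + f3 w).
  apply: ge0_ae_eq_integral => //.
  - exact: measurableT_comp mh mG1.
  - by do 2 apply: emeasurable_funD => //.
  - by move=> w _; rewrite !adde_ge0.
  have n1 := marginal_density_pos mfst ms1 gam1.
  have n2 := marginal_density_pos msnd ms2 gam2.
  have n3 := marginal_density_null mfst ms1 s1_ge0 gam1 (measurableC mT1) nuT1.
  have n4 := marginal_density_null msnd ms2 s2_ge0 gam2 (measurableC mT2) nuT2.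
  apply: negligibleS (negligibleU (negligibleU n1 n2) (negligibleU n3 n4)) => w /= bad.
  apply: contrapT => /not_orP[/not_orP[w1 w2] /not_orP[w3 w4]]; apply: bad => _.
  by apply: plan_cost_regular; [exact/eqP|exact/eqP|exact: contrapT|exact: contrapT].
rewrite ge0_integralD//; last 2 first.
- by move=> w _; rewrite adde_ge0.
- exact: emeasurable_funD.
rewrite ge0_integralD//.
by rewrite [leLHS]addeAC [X in X + _ <= _]addeACA.
Qed.

End conic_plan.

(** * From transport plans to the Sturm distance *)

Section conic_le_transport.
Local Open Scope ereal_scope.
Context (R : realType) (a p : R) (F l : R -> \bar R).
Hypothesis hET : regular_ET a F l.
Hypothesis hp : (1 <= p)%R.
Context (X1 X2 : polishMetricType R) (x1 : X1) (x2 : X2).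
Variables (mu1 : fmeas R X1) (mu2 : fmeas R X2).

Local Notation M1 := (fine (mu1 setT)).
Local Notation M2 := (fine (mu2 setT)).
Local Notation K := (((M1 `^ a + M2 `^ a) `^ a^-1)%R).

Lemma CGW_ge0 : 0 <= CGW F l p x1 x2 mu1 mu2.
Proof.
have [_ [FG0 Fsup _] [l0 _ _ _] _] := hET.
apply: le_ereal_inf_tmp => _ [al _ <-].
apply: integral_ge0 => z _; apply: integral_ge0 => z' _.
by apply: perspective_ge0 => //; rewrite ?powR_ge0 ?l0.
Qed.

(** Settles the case of a zero factor in the final inequality: the null measure is then an
    admissible conic plan. *)
Lemma CGW_null : mu1 setT = 0 -> mu2 setT = 0 -> CGW F l p x1 x2 mu1 mu2 = 0.
Proof.
move=> mu10 mu20; apply/eqP; rewrite eq_le CGW_ge0 andbT.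
have null (Y : polishMetricType R) (mu : fmeas R Y) (A : set (borel Y)) :
    mu setT = 0 -> measurable A -> mu A = 0.
  by move=> mu0 mA; exact: (@subset_measure0 _ _ _ mu A setT).
apply: ereal_inf_lbound.
exists ([the {finite_measure set (borel (cone X1 * cone X2)%type) -> \bar R} of mzero]).
  by split => A mA; rewrite /hmarginal integral_measure_zero null.
by rewrite /conic_energy integral_measure_zero.
Qed.

Section common_space.
Variables (X : polishMetricType R) (psi1 : supp mu1 -> X) (psi2 : supp mu2 -> X).
Variables (nu1 nu2 : fmeas R X).
Hypothesis ipsi1 : isometric_embedding psi1.
Hypothesis ipsi2 : isometric_embedding psi2.
Hypothesis pnu1 : is_supp_pushforward psi1 nu1.
Hypothesis pnu2 : is_supp_pushforward psi2 nu2.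

Lemma CGW_le_transport_plan (gam : fmeas R (X * X)%type) :
  divergence F (pushforward gam (fst : borel (X * X)%type -> borel X)) nu1 < +oo ->
  divergence F (pushforward gam (snd : borel (X * X)%type -> borel X)) nu2 < +oo ->
  CGW F l p x1 x2 mu1 mu2 <= K%:E *
    (divergence F (pushforward gam (fst : borel (X * X)%type -> borel X)) nu1
    + divergence F (pushforward gam (snd : borel (X * X)%type -> borel X)) nu2
    + \int[gam]_z l (mdist z.1 z.2)).
Proof.
move=> D1y D2y; have [_ [FG0 Fsup _] _ _] := hET.
have mF := measurable_regular_ET_entropy hET.
have mfst : measurable_fun setT (fst : borel (X * X)%type -> borel X).
  by apply: continuous_borel => z; exact: cvg_fst.
have msnd : measurable_fun setT (snd : borel (X * X)%type -> borel X).
  by apply: continuous_borel => z; exact: cvg_snd.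
have dens (pr : borel (X * X)%type -> borel X) (nu : fmeas R X) : measurable_fun setT pr ->
    divergence F (pushforward gam pr) nu < +oo ->
    exists s : X -> R, [/\ measurable_fun setT (s : borel X -> R), forall x, (0 <= s x)%R,
      forall A, measurable A -> pushforward gam pr A = \int[nu]_(x in A) (s x)%:E &
      \int[nu]_x F (s x) = divergence F (pushforward gam pr) nu].
  move=> mpr Dy; have [g gE] := finite_image_measure gam mpr.
  have gE' : pushforward gam pr = g by apply/funext => A; rewrite gE.
  rewrite gE' in Dy *; exact: (divergence_attained FG0 Fsup mF Dy).
have [s1 [ms1 s10 gam1 <-]] := dens _ _ mfst D1y.
have [s2 [ms2 s20 gam2 <-]] := dens _ _ msnd D2y.
have [Psi1 [phi1 [T1 [mPsi1 mphi1 phi1P iso1 [mT1 nuT1 nuphi1]]]]] :=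
  isometric_supp_inverse ipsi1 pnu1.
have [Psi2 [phi2 [T2 [mPsi2 mphi2 phi2P iso2 [mT2 nuT2 nuphi2]]]]] :=
  isometric_supp_inverse ipsi2 pnu2.
have msupp (Y : polishMetricType R) (mu : fmeas R Y) : measurable (supp mu : set (borel Y)).
  by apply: closed_borel; exact: closed_supp.
have [al [al1 al2] alh] := conic_plan_exists hET hp x1 x2 mPsi1 mPsi2 mphi1 mphi2
  (msupp _ mu1) (msupp _ mu2) mT1 mT2 phi1P phi2P nuT1 nuT2 nuphi1 nuphi2
  ms1 ms2 s10 s20 gam1 gam2.
apply: (@le_trans _ _ (conic_energy F l p x1 x2 al)).
  by apply: ereal_inf_lbound; exists al.
have M10 : (0 <= M1)%R by rewrite fine_ge0.
have M20 : (0 <= M2)%R by rewrite fine_ge0.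
have E1 : \int[al]_z (r1 z `^ p)%:E = M1%:E.
  by rewrite fineK ?fin_num_measure// -(al1 setT measurableT) /hmarginal preimage_setT.
have E2 : \int[al]_z (r2 z `^ p)%:E = M2%:E.
  by rewrite fineK ?fin_num_measure// -(al2 setT measurableT) /hmarginal preimage_setT.
apply: (le_trans (conic_energy_le hET hp x1 x2 iso1 iso2 mPsi1 mPsi2
   (msupp _ mu1) (msupp _ mu2) M10 M20 E1 E2)).
by apply: lee_wpmul2l; rewrite ?lee_fin ?powR_ge0.
Qed.

Lemma CGW_le_ET : CGW F l p x1 x2 mu1 mu2
  <= K%:E * ET F (fun z : X * X => l (mdist z.1 z.2)) nu1 nu2.
Proof.
have [/andP[a0 _] [FG0 Fsup _] [l0 _ _ _] /(_ X)[[Dfin _ _ _] _ _ _]] := hET.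
(* Finiteness of the metric guarantees a plan of finite cost, which is all that is needed when [K]
   is 0. *)
have ETy : ET F (fun z : X * X => l (mdist z.1 z.2)) nu1 nu2 < +oo.
  have /andP[_] := Dfin nu1 nu2; apply: lty_poweRy; by rewrite gt_eqF.
have CGW_le v : ET F (fun z : X * X => l (mdist z.1 z.2)) nu1 nu2 < v ->
    exists2 w, w < v & CGW F l p x1 x2 mu1 mu2 <= K%:E * w.
  move=> /ereal_inf_lt[_ [g _ <-] gv]; eexists; first exact: gv.
  have D10 := divergence_ge0 FG0 Fsup (pushforward g (fst : borel (X * X)%type -> borel X)) nu1.
  have D20 := divergence_ge0 FG0 Fsup (pushforward g (snd : borel (X * X)%type -> borel X)) nu2.
  have L0 : 0 <= \int[g]_z l (mdist z.1 z.2).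
    by apply: integral_ge0 => z _; rewrite l0// mdist_ge0.
  have gvy := lt_le_trans gv (leey v).
  apply: CGW_le_transport_plan; apply: le_lt_trans gvy.
    by rewrite -addeA leeDl// adde_ge0.
  by rewrite addeAC leeDr// adde_ge0.
have K0 : (0 <= K)%R by exact: powR_ge0.
(* For K > 0 the bound for almost optimal plans passes to the infimum after division by [K]. *)
have [KE|KN] := eqVneq K 0%R.
  by have [w _] := CGW_le _ ETy; rewrite KE !mul0e.
have Kp : (0 < K)%R by rewrite lt_def KN.
rewrite -lee_pdivrMl//; rewrite leNgt; apply/negP => /CGW_le[w wlt].
by rewrite -lee_pdivrMl// leNgt wlt.
Qed.

End common_space.

Lemma CGW_poweR_le_ET_dist (X : polishMetricType R)
    (psi1 : supp mu1 -> X) (psi2 : supp mu2 -> X) (nu1 nu2 : fmeas R X) :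
  isometric_embedding psi1 -> isometric_embedding psi2 ->
  is_supp_pushforward psi1 nu1 -> is_supp_pushforward psi2 nu2 ->
  CGW F l p x1 x2 mu1 mu2 `^ a
    <= (mu1 setT `^ a + mu2 setT `^ a) * ET_dist a F l nu1 nu2.
Proof.
move=> i1 i2 q1 q2.
have [/andP[a0 _] [FG0 Fsup _] [l0 _ _ _] _] := hET.
have ET0 : 0 <= ET F (fun z : X * X => l (mdist z.1 z.2)) nu1 nu2.
  apply: le_ereal_inf_tmp => _ [g _ <-].
  apply: adde_ge0; first by apply: adde_ge0; exact: divergence_ge0.
  by apply: integral_ge0 => z _; rewrite l0// mdist_ge0.
have KE : (mu1 setT `^ a + mu2 setT `^ a) = K%:E `^ a.
  rewrite poweR_EFin -powRrM mulVf ?gt_eqF// powRr1; last by rewrite addr_ge0// powR_ge0.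
  by rewrite EFinD -!poweR_EFin !fineK ?fin_num_measure.
have K0 : (0 <= K)%R by exact: powR_ge0.
rewrite KE /ET_dist -poweRM ?lee_fin//.
apply: (gt0_ler_poweR (ltW a0)); rewrite ?in_itv/= ?leey ?CGW_ge0 ?mule_ge0 ?lee_fin//.
exact: CGW_le_ET.
Qed.

End conic_le_transport.

Local Open Scope ereal_scope.

Theorem proposition5 (R : realType) (a p : R) (F l : R -> \bar R)
    (hET : regular_ET a F l) (hp : (1 <= p)%R)
    (X1 X2 : polishMetricType R) (x1 : X1) (x2 : X2)
    (mu1 : fmeas R X1) (mu2 : fmeas R X2) :
  (CGW F l p x1 x2 mu1 mu2) `^ a
    <= ((mu1 setT) `^ a + (mu2 setT) `^ a) * sturm_ET a F l mu1 mu2.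
Proof.
have [/andP[a0 _] _ _ _] := hET.
have mu1fin : mu1 setT `^ a \is a fin_num by rewrite fin_num_poweR// fin_num_measure.
have mu2fin : mu2 setT `^ a \is a fin_num by rewrite fin_num_poweR// fin_num_measure.
(* The infimum over common spaces is reached by dividing by the factor, so its vanishing, when both
   measures are null, is treated apart. *)
have [C0|CN] := eqVneq (mu1 setT `^ a + mu2 setT `^ a) 0.
  have /andP[/eqP/poweR_eq0_eq0 m1 /eqP/poweR_eq0_eq0 m2] :
      (mu1 setT `^ a == 0) && (mu2 setT `^ a == 0).
    by rewrite -padde_eq0 ?poweR_ge0// C0.
  have -> : CGW F l p x1 x2 mu1 mu2 = 0.
    exact: (CGW_null p hET x1 x2 (m1 (measure_ge0 _ _)) (m2 (measure_ge0 _ _))).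
  by rewrite C0 mul0e poweR0r ?gt_eqF.
have Cge0 : 0 <= mu1 setT `^ a + mu2 setT `^ a by rewrite adde_ge0 ?poweR_ge0.
have Cfin : mu1 setT `^ a + mu2 setT `^ a \is a fin_num by rewrite fin_numD mu1fin.
move: (mu1 setT `^ a + mu2 setT `^ a) CN Cge0 Cfin
  (@CGW_poweR_le_ET_dist R a p F l hET hp X1 X2 x1 x2 mu1 mu2) => [C||]//.
rewrite eqe lee_fin => CN C0 _ CGW_le.
have Cp : (0 < C)%R by rewrite lt_def CN.
rewrite -lee_pdivrMl//; apply: le_ereal_inf_tmp.
move=> _ [X [psi1 [psi2 [nu1 [nu2 [i1 i2 q1 q2 ->]]]]]].
by rewrite lee_pdivrMl//; exact: CGW_le i1 i2 q1 q2.
Qed.
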